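(* Let $k \ge 5$ be a natural number and let $h_k$ be a non-zero homogeneous harmonic polynomial of degree $k$ in two real variables $x,y$. For $s \in \{1,2,\ldots,k-4\}$ define $$\sigma_s = \begin{cases} s+1 & \text{if } s < \frac{k-3}{2},\\ s+2 & \text{if } s \ge \frac{k-3}{2}.\end{cases}$$ Then for every choice of $\rho_{k+s} \in \operatorname{Ker} \Delta_{k+s}^{\sigma_s}$ (for all $s \in \{1,\ldots,k-4\}$) and every $R_{2k-3} \in \mathfrak{m}_2^{2k-3}$, the function-germs $h_k$ and $h_k + \sum_{s=1}^{k-4} \rho_{k+s} + R_{2k-3}$ at $\mathbf{0} \in \mathbf{R}^2$ are right equivalent.
   Context: $\Delta = \frac{\partial^2}{\partial x^2} + \frac{\partial^2}{\partial y^2}$ is the Laplacian on $\mathbf{R}^2$; a polynomial $h$ is harmonic if $\Delta h = 0$. $P_m$ denotes the real vector space of all homogeneous polynomials of degree $m$ in $x,y$ with real coefficients (including $0$). For natural numbers $m \ge 2s$, $\Delta_m^s \colon P_m \to P_{m-2s}$ is the linear map given by applying $\Delta$ $s$ times, so $\operatorname{Ker} \Delta_m^s = \{p \in P_m : \Delta^s p = 0\}$. $\mathcal{E}_2$ is the ring of $C^\infty$ function-germs $(\mathbf{R}^2,\mathbf{0}) \to \mathbf{R}$, $\mathfrak{m}_2 \subset \mathcal{E}_2$ is the ideal of germs vanishing at $\mathbf{0}$, and $\mathfrak{m}_2^{r}$ is its $r$-th power. Two germs $h_1,h_2 \colon (\mathbf{R}^2,\mathbf{0}) \to (\mathbf{R},0)$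 are right equivalent if there is a $C^\infty$ diffeomorphism-germ $\varphi \colon (\mathbf{R}^2,\mathbf{0}) \to (\mathbf{R}^2,\mathbf{0})$ with $h_1 \circ \varphi = h_2$. *)

(* Defs.v *)
From mathcomp Require Import all_boot all_order all_algebra.
From mathcomp Require Import all_classical all_reals all_analysis.
(* The notations of [mpoly] clash with those of MathComp-Analysis. *)
From mathcomp Require Import -(notations) mpoly.

Set Implicit Arguments.
Unset Strict Implicit.
Unset Printing Implicit Defensive.

Import Order.TTheory GRing.Theory Num.Theory.
Import numFieldNormedType.Exports.

Local Open Scope classical_set_scope.
Local Open Scope ring_scope.

(* The zero polynomial is homogeneous of every degree. *)
Definition homogeneous_poly (R : realType) (m : nat) (p : mpoly 2 R) : bool :=
  p \is ishomog1 m mdeg.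

Definition laplacian (R : realType) (p : mpoly 2 R) : mpoly 2 R :=
  \sum_(i < 2) mderiv i (mderiv i p).

Definition harmonic_poly (R : realType) (p : mpoly 2 R) : Prop := laplacian p = 0.

Definition ker_laplacian (R : realType) (m s : nat) (p : mpoly 2 R) : Prop :=
  homogeneous_poly m p /\ iter s (@laplacian R) p = 0.

(* The first test is [s < (k - 3) / 2] over the reals, cleared of its
   denominator; [k - 3] is not truncated when [3 <= k]. *)
Definition sigma (k s : nat) : nat :=
  if (2 * s < k - 3)%N then s.+1 else s.+2.

Definition poly_fun (R : realType) (p : mpoly 2 R) : 'rV[R]_2 -> R :=
  fun x => meval (fun i => x 0 i) p.

(* Germs at the origin are handled through representatives: total functions
   whose values matter only near [0]. *)

(* [iter_partial [:: i1; ...; ir] f] is the partial derivative of [f] along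
   [ir], ..., [i1] in turn. *)
Definition iter_partial (R : realType) (W : normedModType R)
    (s : seq 'I_2) (f : 'rV[R]_2 -> W) : 'rV[R]_2 -> W :=
  foldr (fun i g => 'D_(delta_mx 0 i) g) f s.

(* All iterated partial derivatives exist and are continuous on one and the
   same open neighbourhood of the origin. *)
Definition smooth_germ (R : realType) (W : normedModType R)
    (f : 'rV[R]_2 -> W) : Prop :=
  exists2 U : set 'rV[R]_2, open_nbhs (0 : 'rV[R]_2) U &
    forall (s : seq 'I_2) (x : 'rV[R]_2), U x ->
      {for x, continuous (iter_partial s f)} /\
      forall i : 'I_2, derivable (iter_partial s f) x (delta_mx 0 i).

Definition maximal_ideal (R : realType) (f : 'rV[R]_2 -> R) : Prop :=
  smooth_germ f /\ f 0 = 0.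

(* The [r]-th power of the maximal ideal, i.e. the ideal generated by the
   products of [r] of its elements. *)
Definition maximal_ideal_pow (R : realType) (r : nat) (f : 'rV[R]_2 -> R) :
    Prop :=
  exists (N : nat) (c : 'I_N -> 'rV[R]_2 -> R)
         (g : 'I_N -> 'I_r -> 'rV[R]_2 -> R),
    [/\ forall i, smooth_germ (c i),
        forall i j, maximal_ideal (g i j) &
        \forall x \near (0 : 'rV[R]_2),
          f x = \sum_(i < N) c i x * \prod_(j < r) g i j x].

Definition diffeo_germ (R : realType) (phi : 'rV[R]_2 -> 'rV[R]_2) : Prop :=
  [/\ smooth_germ phi, phi 0 = 0 &
      exists psi : 'rV[R]_2 -> 'rV[R]_2,
        [/\ smooth_germ psi, psi 0 = 0,
            \forall x \near (0 : 'rV[R]_2), psi (phi x) = x &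
            \forall y \near (0 : 'rV[R]_2), phi (psi y) = y]].

Definition right_equivalent (R : realType) (h1 h2 : 'rV[R]_2 -> R) : Prop :=
  exists2 phi : 'rV[R]_2 -> 'rV[R]_2, diffeo_germ phi &
    \forall x \near (0 : 'rV[R]_2), h1 (phi x) = h2 x.

(* Main.v *)
From HB Require Import structures.
Require Import Defs.
From mathcomp Require Import all_boot all_order all_algebra.
From mathcomp Require Import all_classical all_reals all_analysis.
From mathcomp Require Import -(notations) mpoly.
From mathcomp Require Import complex.
From mathcomp Require Import zify ring lra.

Set Implicit Arguments.
Unset Strict Implicit.
Unset Printing Implicit Defensive.

Import Order.TTheory GRing.Theory Num.Theory.
Import numFieldNormedType.Exports.

Local Open Scope classical_set_scope.
Local Open Scope ring_scope.

(** Write [z = x + i y]. A non-zero harmonic form of degree [k] is the real part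
    of [c0 z^k] with [c0 != 0] ([harmonic_poly_funE]). The proof finds a change of
    coordinates of the shape [phi = (1 + w) (z + zbar^q b)], where
    [q] is half of [k] rounded down and [w], [b] are smooth complex-valued
    unknowns with [w] vanishing at the origin.

    The perturbations are all of the form [Re (c0 (z^k W + z^(k-1) zbar^q c))]
    with [W] and [c] smooth and [W 0 = 0]. Indeed, in the coordinates
    [z], [zbar] the Laplacian is four times the product of the two derivations
    ([to_zzbar_laplacian]), so that a monomial of a polynomial killed by its
    [s]-th power contains [z] or [zbar] to a power below [s]
    ([laplacian_kernel]), and so the other one to a high power. The function
    [sigma] is what makes that power at least [k], or [k - 1] with at least [q]
    factors of the other kind. For the remainder, Hadamard's lemma
    ([hadamard]) writes a germ of order [2k - 3] as a combination with smooth
    coefficients of monomials of degree [2k - 3] in [z] and [zbar], one exponent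
    of which is at least [k - 1]. Finally [z] and [zbar] may be exchanged, since
    conjugation does not change real parts ([absorbable_monomial]).

    It remains to solve [Re (c0 phi^k) = Re (c0 (z^k (1 + W) + z^(k-1) zbar^q c))].
    In the binomial expansion of [phi^k] the first two terms are
    [z^k (1 + w)^k] and [k z^(k-1) zbar^q (1 + w)^k b]. The [j]-th one contains
    only [z^(k-j)], but its conjugate contains [z^(qj)], where [qj] is at least
    [2q], hence at least [k - 1]: under the real part, all the terms with [j] at
    least 2 are multiples of [z^k] or of [z^(k-1) zbar^q], with cofactors that
    vanish at the origin whatever [w] and [b] are ([Re_power_expansion]). Comparing
    the cofactors of [z^k] and of [z^(k-1) zbar^q] gives two equations for [w]
    and [b], no differential equation being involved. They take the form
    [(w, b) = T (x, w, b)] with the derivative of [T] in [(w, b)] equal to 0 at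
    the base point, which [smooth_fixed_point] solves by a contraction argument
    ([absorb_perturbation]). As [w] vanishes at the origin and [q] is at least 2,
    the differential of [phi] there is the identity; the same fixed point theorem
    inverts it ([diffeo_germ_unit_jacobian]). *)

(** * Functions of class C^m on an open set *)

Section Differentiability.
Context {R : realType} {V W : normedModType R}.
Implicit Types (f g : V -> W).

(** With [eps_is_diff], trades the little-o definition of the differential for
    explicit inequalities, the form in which estimates are proved below. *)
Lemma differentiable_eps f (x : V) : differentiable f x ->
  forall e : R, 0 < e ->
    \forall h \near (0 : V), `|f (h + x) - f x - 'd f x h| <= e * `|h|.
Proof.
move=> /diff_locally/eqaddoP fx e e0; have /= := fx e e0; rewrite near_simpl.
by apply: filterS => h; rewrite /= opprD addrA.
Qed.

Lemma eps_is_diff f (x : V) (L : {linear V -> W}) : continuous L ->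
  (forall e : R, 0 < e ->
    \forall h \near (0 : V), `|f (h + x) - f x - L h| <= e * `|h|) ->
  differentiable f x /\ 'd f x = L :> (V -> W).
Proof.
move=> Lc fx.
have fL : f \o shift x = cst (f x) + L +o_ 0 id.
  apply/eqaddoP => e e0; apply: filterS (fx e e0) => h.
  by rewrite /= opprD addrA.
have dfL := diff_unique Lc fL; split => //.
by apply/diff_locallyP; rewrite dfL.
Qed.

Lemma near_eq_differentiable f g (x : V) :
  (\forall y \near x, f y = g y) -> differentiable f x -> differentiable g x.
Proof.
move=> fg df; have fgx := nbhs_singleton fg.
suff [] : differentiable g x /\ 'd g x = 'd f x :> (V -> W) by [].
apply: eps_is_diff; first exact: diff_continuous.
move=> e e0.
have fg0 : \forall h \near (0 : V), f (h + x) = g (h + x).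
  by move: fg; rewrite (near_shift 0 x) /= subr0.
by apply: filterS2 _ fg0 (differentiable_eps df e0) => h <-; rewrite fgx.
Qed.

End Differentiability.

Section C_on.
Context {R : realType}.
Implicit Types (m : nat) (V : normedModType R).

(** Differentiability together with derivatives in all directions, rather than
    partial derivatives only: this makes sense on any normed space, hence on the
    products of parameter and unknown spaces to which the fixed point theorem
    applies, and it makes the chain rule an induction on [m]. *)
Fixpoint C_on V m (U : set V) (f : V -> R) : Prop :=
  if m is m'.+1 then (forall x, U x -> differentiable f x) /\
    forall v, C_on m' U ('D_v f)
  else forall x, U x -> {for x, continuous f}.

Lemma open_near V (U : set V) x (P : V -> Prop) : open U -> U x ->
  (forall y, U y -> P y) -> \forall y \near x, P y.
Proof. by move=> oU Ux UP; apply: filterS UP _; exact: open_nbhs_nbhs. Qed.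

Lemma eq_C_on V m (U : set V) f g : open U -> (forall x, U x -> f x = g x) ->
  C_on m U f -> C_on m U g.
Proof.
move=> oU; elim: m f g => [|m IH] f g fg /=.
  move=> cf x Ux; have fgx := open_near oU Ux fg.
  have : f y @[y --> x] --> f x := cf x Ux.
  by rewrite fg//; apply: cvg_trans; exact: near_eq_cvg fgx.
move=> [df Df]; split=> [x Ux|v].
  by apply: near_eq_differentiable (df x Ux); exact: open_near fg.
apply: IH (Df v) => x Ux; apply: near_eq_derive; exact: open_near fg.
Qed.

Lemma C_on_subset V m (U U' : set V) f : U' `<=` U -> C_on m U f -> C_on m U' f.
Proof.
move=> UU'; elim: m f => [|m IH] f /=; first by move=> cf x /UU' /cf.
by move=> [df Df]; split=> [x /UU' /df//|v]; exact: IH.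
Qed.

Lemma C_on_continuous V m (U : set V) f : C_on m U f ->
  forall x, U x -> {for x, continuous f}.
Proof.
case: m => [//|m] [df _] x /df dfx; exact: differentiable_continuous dfx.
Qed.

Lemma C_onW V m (U : set V) f : C_on m.+1 U f -> C_on m U f.
Proof.
elim: m f => [|m IH] f; first exact: C_on_continuous.
by move=> [df Df]; split => // v; exact: IH.
Qed.

Lemma C_on_cst V m (U : set V) (c : R) : C_on m U (fun=> c).
Proof.
elim: m c => [|m IH] c /=; first by move=> x _; exact: cvg_cst.
split=> [x _|v]; first exact: differentiable_cst.
rewrite (_ : 'D_v _ = fun=> 0)//; apply/funext => x; exact: derive_cst.
Qed.

Lemma C_onD V m (U : set V) f g : open U -> C_on m U f -> C_on m U g ->
  C_on m U (fun x => f x + g x).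
Proof.
move=> oU; elim: m f g => [|m IH] f g /=.
  by move=> cf cg x Ux; apply: cvgD; [exact: cf|exact: cg].
move=> [df Df] [dg Dg]; split=> [x Ux|v].
  by apply: differentiableD; [exact: df|exact: dg].
apply: eq_C_on (IH _ _ (Df v) (Dg v)) => // x Ux.
by rewrite -deriveD//; apply: diff_derivable; [exact: df|exact: dg].
Qed.

Lemma C_onM V m (U : set V) f g : open U -> C_on m U f -> C_on m U g ->
  C_on m U (fun x => f x * g x).
Proof.
move=> oU; elim: m f g => [|m IH] f g.
  by move=> cf cg x Ux; apply: cvgM; [exact: cf|exact: cg].
move=> Cf Cg; have [df Df] := Cf; have [dg Dg] := Cg; split=> [x Ux|v].
  by apply: differentiableM; [exact: df|exact: dg].
have CfD := IH _ _ (C_onW Cf) (Dg v); have CgD := IH _ _ (C_onW Cg) (Df v).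
apply: eq_C_on (C_onD oU CfD CgD) => // x Ux.
by rewrite [RHS]deriveM//; apply: diff_derivable; [exact: df|exact: dg].
Qed.

Lemma C_onN V m (U : set V) f : open U -> C_on m U f ->
  C_on m U (fun x => - f x).
Proof.
move=> oU Cf; apply: eq_C_on (C_onM oU (C_on_cst m U (-1)) Cf) => // x _.
by rewrite mulN1r.
Qed.

Lemma C_on_sum V m (U : set V) (I : Type) (r : seq I) (P : pred I)
    (f : I -> V -> R) : open U -> (forall i, P i -> C_on m U (f i)) ->
  C_on m U (fun x => \sum_(i <- r | P i) f i x).
Proof.
move=> oU Cf; elim: r => [|i r IH].
  by under eq_fun do rewrite big_nil; exact: C_on_cst.
case Pi: (P i); under eq_fun do rewrite big_cons Pi; last exact: IH.
by apply: C_onD => //; exact: Cf.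
Qed.

Lemma C_on_prod V m (U : set V) (I : Type) (r : seq I) (P : pred I)
    (f : I -> V -> R) : open U -> (forall i, P i -> C_on m U (f i)) ->
  C_on m U (fun x => \prod_(i <- r | P i) f i x).
Proof.
move=> oU Cf; elim: r => [|i r IH].
  by under eq_fun do rewrite big_nil; exact: C_on_cst.
case Pi: (P i); under eq_fun do rewrite big_cons Pi; last exact: IH.
by apply: C_onM => //; exact: Cf.
Qed.

Lemma C_onV V m (U : set V) f : open U -> (forall x, U x -> f x != 0) ->
  C_on m U f -> C_on m U (fun x => (f x)^-1).
Proof.
move=> oU f0; elim: m => [|m IH].
  by move=> cf x Ux; apply: cvgV; [exact: f0|exact: cf].
move=> Cf; have [df Df] := Cf; split=> [x Ux|v].
  by apply: differentiableV; [exact: df|exact: f0].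
have CV := IH (C_onW Cf).
apply: eq_C_on (C_onN oU (C_onM oU (C_onM oU CV CV) (Df v))) => // x Ux.
rewrite [RHS]deriveV ?f0//; last by apply: diff_derivable; exact: df.
by rewrite scaleNr/= -expr2 exprVn.
Qed.

Lemma C_on_linear V m (U : set V) (f : {linear V -> R}) : continuous f ->
  C_on m U f.
Proof.
move=> cf; case: m => [|m] /=; first by move=> x _; exact: cf.
split=> [x _|v]; first exact: linear_differentiable.
have -> : 'D_v f = fun=> f v; last exact: C_on_cst.
apply/funext => x; rewrite deriveE ?diff_lin//; exact: linear_differentiable.
Qed.

Lemma derive_row n (f : 'rV[R]_n -> R) (x v : 'rV[R]_n) : differentiable f x ->
  'D_v f x = \sum_j v 0 j * 'D_(delta_mx 0 j) f x.
Proof.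
move=> df; rewrite deriveE// {1}(row_sum_delta v) linear_sum/=.
by apply: eq_bigr => j _; rewrite linearZ/= deriveE.
Qed.

Lemma row_comb V n (F : 'I_n -> V -> R) :
  (fun x => \row_j F j x) =
  \sum_(j < n) (fun x => F j x *: (delta_mx 0 j : 'rV[R]_n)).
Proof.
apply/funext => x; rewrite [LHS]row_sum_delta fct_sumE.
by apply: eq_bigr => j _; rewrite mxE.
Qed.

Lemma differentiable_row V n (F : 'I_n -> V -> R) x :
  (forall j, differentiable (F j) x) -> differentiable (fun x => \row_j F j x) x.
Proof.
move=> dF; rewrite row_comb; apply: differentiable_sum => j.
exact: differentiableZl.
Qed.

Lemma derive_row_fun V n (F : 'I_n -> V -> R) x v :
  (forall j, differentiable (F j) x) ->
  'D_v (fun x => \row_j F j x) x = \row_j 'D_v (F j) x.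
Proof.
move=> dF; rewrite derive_mx; last first.
  by apply: diff_derivable; exact: differentiable_row.
apply/matrixP => i j; rewrite !mxE; congr ('D_v _ x).
by apply/funext => y; rewrite mxE.
Qed.

Lemma derive_comp_row V n (g : 'rV[R]_n -> R) (F : 'I_n -> V -> R) x v :
  (forall j, differentiable (F j) x) -> differentiable g (\row_j F j x) ->
  'D_v (fun x => g (\row_j F j x)) x =
  \sum_j 'D_v (F j) x * 'D_(delta_mx 0 j) g (\row_j F j x).
Proof.
move=> dF dg; have dr := differentiable_row dF.
rewrite deriveE; last exact: (differentiable_comp dr).
rewrite (diff_comp dr)//= -(deriveE v dr) -(deriveE _ dg) derive_row_fun//.
by rewrite derive_row//; apply: eq_bigr => j _; rewrite mxE.
Qed.

Lemma continuous_row V n (F : 'I_n -> V -> R) x :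
  (forall j, {for x, continuous (F j)}) ->
  {for x, continuous (fun x => \row_j F j x)}.
Proof.
move=> cF; have rE : (fun x => \row_j F j x) =
    (fun x => \sum_(j < n) F j x *: (delta_mx 0 j : 'rV[R]_n)).
  by rewrite row_comb; apply/funext => y; rewrite fct_sumE.
rewrite rE; apply: cvg_big => [|j _]; [exact: add_continuous|apply: cvgZr_tmp; exact: cF].
Qed.

(** The chain rule writes a derivative of the composite as a sum of products of
    a derivative of an inner coordinate with a composite involving a partial
    derivative of [g]; both factors have one order less to go, so the induction
    quantifies over [g]. *)
Lemma C_on_comp V n m (U : set V) (U' : set 'rV[R]_n) (g : 'rV[R]_n -> R)
    (F : 'I_n -> V -> R) : open U -> open U' ->
  (forall x, U x -> U' (\row_j F j x)) ->
  C_on m U' g -> (forall j, C_on m U (F j)) ->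
  C_on m U (fun x => g (\row_j F j x)).
Proof.
move=> oU oU' UU'; elim: m g F UU' => [|m IH] g F UU'.
  move=> cg cF x Ux.
  have cr : {for x, continuous (fun x => \row_j F j x)}.
    by apply: continuous_row => j; exact: cF.
  by apply: (continuous_comp cr); apply: cg; exact: UU'.
move=> [dg Dg] CF; split=> [x Ux|v].
  apply: (@differentiable_comp _ _ _ _ (fun x => \row_j F j x) g).
    by apply: differentiable_row => j; have [] := CF j => + _; apply.
  by apply: dg; exact: UU'.
have CDF j : C_on m U (fun x => 'D_v (F j) x * 'D_(delta_mx 0 j) g (\row_j F j x)).
  apply: C_onM => //; first by have [_] := CF j; apply.
  by apply: (IH ('D_(delta_mx 0 j) g) F UU') => [|i]; [exact: Dg|exact: C_onW].
apply: eq_C_on (C_on_sum (index_enum _) oU (fun j (_ : xpredT j) => CDF j)) => //.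
move=> x Ux; rewrite derive_comp_row//; last by apply: dg; exact: UU'.
by move=> j; have [] := CF j => + _; apply.
Qed.

End C_on.

(** * Smooth germs at a point of a normed space *)

Section SmoothGerm.
Context {R : realType}.
Implicit Types (V : normedModType R).

Definition smooth_at V (a : V) (f : V -> R) : Prop :=
  exists2 U : set V, open_nbhs a U & forall m, C_on m U f.

Lemma near_open V (a : V) (P : V -> Prop) : (\forall x \near a, P x) ->
  exists2 U : set V, open_nbhs a U & forall x, U x -> P x.
Proof. by move=> nP; have : nbhs a P := nP; rewrite nbhsE => -[U]; exists U. Qed.

Lemma eq_smooth_at V (a : V) f g : (\forall x \near a, f x = g x) ->
  smooth_at a f -> smooth_at a g.
Proof.
move=> /near_open[U' [oU' U'a] fg] [U [oU Ua] CU].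
exists (U `&` U'); first by split; [exact: openI|].
move=> m; apply: (@eq_C_on _ _ _ _ f); first exact: openI.
  by move=> x [_ /fg].
by apply: C_on_subset (CU m) => x [].
Qed.

Lemma smooth_at_binary V (a : V) f g (h : (V -> R) -> (V -> R) -> (V -> R)) :
  (forall m U, open U -> C_on m U f -> C_on m U g -> C_on m U (h f g)) ->
  smooth_at a f -> smooth_at a g -> smooth_at a (h f g).
Proof.
move=> Hh [U [oU Ua] CU] [U' [oU' U'a] CU'].
exists (U `&` U'); first by split; [exact: openI|].
move=> m; apply: Hh; first exact: openI.
  by apply: C_on_subset (CU m) => x [].
by apply: C_on_subset (CU' m) => x [].
Qed.

Lemma smooth_at_cst V (a : V) (c : R) : smooth_at a (fun=> c).
Proof.
by exists setT; [split; [exact: openT|]|move=> m; exact: C_on_cst].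
Qed.

Lemma smooth_atD V (a : V) f g : smooth_at a f -> smooth_at a g ->
  smooth_at a (fun x => f x + g x).
Proof.
by apply: (@smooth_at_binary _ a f g (fun f g x => f x + g x)) => *; exact: C_onD.
Qed.

Lemma smooth_atM V (a : V) f g : smooth_at a f -> smooth_at a g ->
  smooth_at a (fun x => f x * g x).
Proof.
by apply: (@smooth_at_binary _ a f g (fun f g x => f x * g x)) => *; exact: C_onM.
Qed.

Lemma smooth_atN V (a : V) f : smooth_at a f -> smooth_at a (fun x => - f x).
Proof.
move=> sf; apply: (@eq_smooth_at _ a (fun x => -1 * f x)).
  by apply: nearW => x; rewrite mulN1r.
by apply: smooth_atM => //; exact: smooth_at_cst.
Qed.

Lemma smooth_atB V (a : V) f g : smooth_at a f -> smooth_at a g ->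
  smooth_at a (fun x => f x - g x).
Proof. by move=> sf sg; apply: smooth_atD => //; exact: smooth_atN. Qed.

Lemma smooth_at_differentiable V (a : V) f : smooth_at a f ->
  differentiable f a.
Proof. by move=> [U [oU Ua] /(_ 1%N)[+ _]]; apply. Qed.

Lemma smooth_at_continuous V (a : V) f : smooth_at a f ->
  {for a, continuous f}.
Proof. by move=> /smooth_at_differentiable/differentiable_continuous. Qed.

Lemma smooth_at_derive V (a v : V) f : smooth_at a f -> smooth_at a ('D_v f).
Proof.
by move=> [U nU CU]; exists U => // m; have [_] := CU m.+1; apply.
Qed.

Lemma C_on_coord n m (U : set 'rV[R]_n) j :
  C_on m U (fun x : 'rV[R]_n => x 0 j).
Proof.
have @f : {linear 'rV[R]_n -> R}.
  by exists (fun N : 'rV[R]_n => N 0 j); do 2![eexists]; do ?[constructor];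
     rewrite ?mxE// => ? *; rewrite ?mxE//; move=> ?; rewrite !mxE.
exact/(@C_on_linear _ _ m U f)/coord_continuous.
Qed.

Lemma smooth_at_coord n (a : 'rV[R]_n) j :
  smooth_at a (fun x : 'rV[R]_n => x 0 j).
Proof.
by exists setT; [split; [exact: openT|]|move=> m; exact: C_on_coord].
Qed.

(** Each coordinate germ comes with its own neighbourhood; composition needs one
    that serves them all. *)
Lemma smooth_at_common V n (a : V) (F : 'I_n -> V -> R) :
  (forall j, smooth_at a (F j)) ->
  exists2 U : set V, open_nbhs a U & forall j m, C_on m U (F j).
Proof.
move=> sF; have : forall j, exists U, open_nbhs a U /\ forall m, C_on m U (F j).
  by move=> j; have [U nU CU] := sF j; exists U.
move=> /boolp.choice[U nU].
have : \forall x \near a, forall j, U j x.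
  by apply: filter_forall => j; have [? _] := nU j; exact: open_nbhs_nbhs.
move=> /near_open[U' nU' UU']; exists U' => // j m.
by have [_ CU] := nU j; apply: C_on_subset (CU m) => x /UU'; exact.
Qed.

Lemma smooth_at_comp V n (a : V) (g : 'rV[R]_n -> R) (F : 'I_n -> V -> R) :
  smooth_at (\row_j F j a) g -> (forall j, smooth_at a (F j)) ->
  smooth_at a (fun x => g (\row_j F j x)).
Proof.
move=> [U' [oU' U'a] Cg] sF; have [U nU CF] := smooth_at_common sF.
have cF : {for a, continuous (fun x => \row_j F j x)}.
  by apply: continuous_row => j; exact: smooth_at_continuous.
have : \forall x \near a, U x /\ U' (\row_j F j x).
  near=> x; split; near: x; first exact: open_nbhs_nbhs.
  by apply: cF; exact: open_nbhs_nbhs.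
move=> /near_open[D [oD Da] DU]; exists D => // m.
apply: (C_on_comp oD oU' _ (Cg m)) => [x Dx|j]; first by have [] := DU x Dx.
by apply: C_on_subset (CF j m) => x /DU[].
Unshelve. all: by end_near. Qed.

Lemma smooth_at_sum V (a : V) (I : Type) (r : seq I) (P : pred I)
    (f : I -> V -> R) : (forall i, P i -> smooth_at a (f i)) ->
  smooth_at a (fun x => \sum_(i <- r | P i) f i x).
Proof.
move=> sf; elim: r => [|i r IH].
  by under eq_fun do rewrite big_nil; exact: smooth_at_cst.
case Pi: (P i); under eq_fun do rewrite big_cons Pi; last exact: IH.
by apply: smooth_atD => //; exact: sf.
Qed.

(** The one-variable mean value theorem along a segment. The sign of [s] is
    arbitrary, which spares the users a case distinction on coordinates. *)
Lemma line_MVT V (f : V -> R) (x v : V) (s : R) :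
  (forall t : R, 0 <= t <= 1 -> derivable f (x + (t * s) *: v) v) ->
  exists2 t : R, 0 <= t <= 1 &
    f (x + s *: v) - f x = s * 'D_v f (x + (t * s) *: v).
Proof.
move=> df; have [s0|s0] := eqVneq s 0.
  by exists 0; rewrite ?lexx ?ler01// s0 scale0r addr0 subrr mul0r.
pose g (t : R) := f (x + t *: v).
have Dc (c : R) : c \in `[Num.min 0 s, Num.max 0 s] -> 0 <= c / s <= 1.
  rewrite in_itv/=; case: (ltgtP 0 s) s0 => // s0 _ /andP[c1 c2].
    by rewrite ler_pdivlMr// ler_pdivrMr// mul0r mul1r c1.
  by rewrite ler_ndivlMr// ler_ndivrMr// mul0r mul1r c2.
have dg (t : R) : t \in `[Num.min 0 s, Num.max 0 s] ->
    is_derive t 1 g ('D_v f (x + t *: v)).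
  have E : (fun h : R => h^-1 *: ((g \o shift t) (h *: 1) - g t)) =
      (fun h => h^-1 *: ((f \o shift (x + t *: v)) (h *: v) - f (x + t *: v))).
    apply/funext => h /=; rewrite /g scalerDl addrCA.
    by rewrite (_ : h *: 1 = h) ?[h *: 1]mulr1.
  move=> /Dc ts; apply: DeriveDef; last by rewrite /derive E.
  by rewrite /derivable E; have := df _ ts; rewrite divfK.
have cg : {within `[Num.min 0 s, Num.max 0 s], continuous g}.
  by apply: derivable_within_continuous => t /dg[].
have MM : Num.min 0 s <= Num.max 0 s by rewrite ge_min !le_max lexx.
have dgo t : t \in `]Num.min 0 s, Num.max 0 s[ ->
    is_derive t 1 g ('D_v f (x + t *: v)).
  by move=> tI; exact: (dg t (subset_itv_oo_cc tI)).
have [c ci gE] := @MVT_segment R g (fun t : R => 'D_v f (x + t *: v)) _ _ MM dgo cg.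
exists (c / s); first exact: Dc.
rewrite divfK//; move: gE; rewrite /g /Num.min /Num.max/=; case: ltP => _.
  by rewrite scale0r addr0 subr0 mulrC.
rewrite scale0r addr0 sub0r mulrN => /(congr1 -%R); rewrite opprB opprK => ->.
by rewrite mulrC.
Unshelve. all: by end_near. Qed.

End SmoothGerm.

(** * Partial derivatives and smoothness *)

Section RowNorm.
Context {R : realType}.

Lemma coord_le_norm n (v : 'rV[R]_n) j : `|v 0 j| <= `|v|.
Proof.
rewrite [leRHS]/Num.norm /= mx_normrE; apply: (le_bigmax _ _ (0, j)).
Qed.

Lemma row_norm_le n (v : 'rV[R]_n) (M : R) : 0 <= M ->
  (forall j, `|v 0 j| <= M) -> `|v| <= M.
Proof.
move=> M0 vM; rewrite [leLHS]/Num.norm /= mx_normrE; apply/bigmax_leP; split => //.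
by case=> i j _ /=; rewrite (ord1 i).
Qed.

Lemma row_norm_lt n (v : 'rV[R]_n) (M : R) : 0 < M ->
  (forall j, `|v 0 j| < M) -> `|v| < M.
Proof.
move=> M0 vM; rewrite [ltLHS]/Num.norm /= mx_normrE; apply/bigmax_ltP; split => //.
by case=> i j _ /=; rewrite (ord1 i).
Qed.

End RowNorm.

Section SmoothPartial.
Context {R : realType}.

(** The definition of smooth germs mentions partial derivatives only. Moving from
    [x] to [x + h] along the first axis, then along the second, the mean value
    theorem expresses the increment by partial derivatives at points within
    [`|h|] of [x], and continuity makes them close to those at [x]. *)
Lemma C1_differentiable (U : set 'rV[R]_2) (f : 'rV[R]_2 -> R) : open U ->
  (forall j x, U x -> derivable f x (delta_mx 0 j)) ->
  (forall j x, U x -> {for x, continuous ('D_(delta_mx 0 j) f)}) ->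
  forall x, U x -> differentiable f x.
Proof.
move=> oU df cDf x Ux.
have Llin : linear (fun h : 'rV[R]_2 => \sum_j h 0 j * 'D_(delta_mx 0 j) f x).
  move=> a u v; rewrite scaler_sumr -big_split/=; apply: eq_bigr => j _.
  by rewrite !mxE mulrDl scalerAl.
pose LM := GRing.isLinear.Build _ _ _ _ _ Llin.
pose L : {linear 'rV[R]_2 -> R} :=
  HB.pack (fun h : 'rV[R]_2 => \sum_j h 0 j * 'D_(delta_mx 0 j) f x) LM.
have cL : continuous L.
  move=> h; apply: smooth_at_continuous; apply: smooth_at_sum => j _.
  by apply: smooth_atM; [exact: smooth_at_coord|exact: smooth_at_cst].
suff [] : differentiable f x /\ 'd f x = L :> (_ -> _) by [].
apply: eps_is_diff => // e e0.
have e20 : 0 < e / 2 by rewrite divr_gt0.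
have : \forall y \near x, U y /\ forall j,
    `|'D_(delta_mx 0 j) f x - 'D_(delta_mx 0 j) f y| <= e / 2.
  near=> y; split; first by near: y; exact: open_nbhs_nbhs.
  near: y; apply: filter_forall => j.
  by have /cvgrPdist_le := cDf j x Ux; apply.
move=> /nbhs_ballP[d /= d0 dU]; near=> h.
have hd : `|h| < d.
  by near: h; apply/nbhs_ballP; exists d => // y; rewrite -ball_normE/= sub0r normrN.
have inU (v : 'rV[R]_2) : `|v| <= `|h| -> ball x d (x + v).
  by move=> vh; rewrite -ball_normE/= opprD addNKr normrN (le_lt_trans vh).
pose e0' : 'rV[R]_2 := delta_mx 0 0; pose e1 : 'rV[R]_2 := delta_mx 0 1.
have vE (a b : R) : `|a| <= `|h| -> `|b| <= `|h| ->
    `|a *: e0' + b *: e1| <= `|h|.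
  move=> ah bh; apply: row_norm_le => // j; rewrite !mxE/=.
  case: j => -[|[|//]] /= ?; rewrite ?eqE/= ?eqE/= !(mulr1, mulr0, addr0, add0r)//.
have hE : h = h 0 0 *: e0' + h 0 1 *: e1.
  by rewrite {1}(row_sum_delta h) big_ord_recl big_ord1; congr (_ + h 0 _ *: delta_mx 0 _); apply: val_inj.
have tb (t a : R) : 0 <= t <= 1 -> `|a| <= `|h| -> `|t * a| <= `|h|.
  by move=> /andP[t0 t1]; apply: le_trans; rewrite normrM ger0_norm// ler_piMl.
have [|t0 t00 f0] := @line_MVT R _ f x e0' (h 0 0).
  move=> t t01; apply: df; have [] // := dU (x + (t * h 0 0) *: e0').
  apply: inU; rewrite -[(t * _) *: _]addr0 -(scale0r e1).
  by apply: vE; [apply: tb => //; exact: coord_le_norm|rewrite normr0].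
have [|t1 t11 f1] := @line_MVT R _ f (x + h 0 0 *: e0') e1 (h 0 1).
  move=> t t01; apply: df; rewrite -addrA.
  have [] // := dU (x + (h 0 0 *: e0' + (t * h 0 1) *: e1)); apply: inU.
  by apply: vE; [|apply: tb => //]; exact: coord_le_norm.
have -> : f (h + x) - f x - L h =
  h 0 1 * ('D_e1 f (x + h 0 0 *: e0' + (t1 * h 0 1) *: e1) - 'D_e1 f x) +
  h 0 0 * ('D_e0' f (x + (t0 * h 0 0) *: e0') - 'D_e0' f x).
  have -> : L h = h 0 0 * 'D_e0' f x + h 0 1 * 'D_e1 f x.
    rewrite /L/= big_ord_recl big_ord1; congr (_ + h 0 _ * 'D_(delta_mx 0 _) f x);
    exact: val_inj.
  have -> : f (h + x) = f (x + h 0 0 *: e0' + h 0 1 *: e1).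
    by rewrite -addrA -hE addrC.
  rewrite !mulrBr -f0 -f1; ring.
have -> : e * `|h| = `|h| * (e / 2) + `|h| * (e / 2).
  by rewrite -mulrDr -splitr mulrC.
rewrite (le_trans (ler_normD _ _))// lerD// normrM ler_pM ?coord_le_norm//.
  rewrite distrC -addrA; apply: (dU _ (inU _ _)).2.
  by apply: vE; [|apply: tb => //]; exact: coord_le_norm.
rewrite distrC; apply: (dU _ (inU _ _)).2.
rewrite -[(t0 * _) *: _]addr0 -(scale0r e1).
by apply: vE; [apply: tb => //; exact: coord_le_norm|rewrite normr0].
Unshelve. all: by end_near. Qed.

(** This lemma and the next are the bridge between the two notions of smoothness:
    all the analysis is carried out with [smooth_at]. *)
Lemma smooth_germ_smooth_at (f : 'rV[R]_2 -> R) : smooth_germ f -> smooth_at 0 f.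
Proof.
move=> [U [oU U0] fU]; exists U => // m.
suff : forall s, C_on m U (iter_partial s f) by move=> /(_ [::]).
elim: m => [|m IH] s; first by move=> x Ux; have [] := fU s x Ux.
have df x : U x -> differentiable (iter_partial s f) x.
  apply: C1_differentiable => // j y Uy; first by have [_] := fU s y Uy.
  by have [] := fU (j :: s) y Uy.
split=> // v; apply: (@eq_C_on _ _ _ _
    (fun x => \sum_j v 0 j * 'D_(delta_mx 0 j) (iter_partial s f) x)) => //.
  by move=> x Ux; rewrite [RHS]derive_row//; exact: df.
apply: C_on_sum => // j _; apply: C_onM => //; first exact: C_on_cst.
exact: (IH (j :: s)).
Qed.

Lemma smooth_at_smooth_germ n (F : 'I_n -> 'rV[R]_2 -> R) :
  (forall j, smooth_at 0 (F j)) -> smooth_germ (fun x => \row_j F j x).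
Proof.
move=> /smooth_at_common[U nU CF]; exists U => //; have [oU _] := nU.
have CpF s j m : C_on m U (iter_partial s (F j)).
  by elim: s m => [|i s IH] m //=; have [_] := IH m.+1; apply.
have dpF s j x : U x -> differentiable (iter_partial s (F j)) x.
  by have [+ _] := CpF s j 1%N; apply.
have pE s x : U x -> iter_partial s (fun x => \row_j F j x) x =
    \row_j iter_partial s (F j) x.
  elim: s x => [//|i s IH] x Ux /=.
  rewrite (@near_eq_derive _ _ _ _ (fun x => \row_j iter_partial s (F j) x)).
    by rewrite derive_row_fun// => j; exact: dpF.
  exact: open_near oU Ux IH.
move=> s x Ux.
have dp : differentiable (iter_partial s (fun x => \row_j F j x)) x.
  apply: (@near_eq_differentiable _ _ _ (fun x => \row_j iter_partial s (F j) x)).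
    by apply: (open_near oU Ux) => y Uy; rewrite pE.
  by apply: differentiable_row => j; exact: dpF.
split; first exact: differentiable_continuous.
by move=> i; exact: diff_derivable.
Qed.

End SmoothPartial.

(** * Hadamard's lemma *)

Section Mean.
Context {R : realType}.
Implicit Types (f g : R -> R).

Definition cont01 f := forall t : R, 0 <= t <= 1 -> {for t, continuous f}.

Definition mean f : R := \int[@lebesgue_measure R]_(t in `[0, 1]) f t.

Lemma cont01_integrable f : cont01 f ->
  (@lebesgue_measure R).-integrable `[0, 1] (EFin \o f).
Proof.
move=> cf; apply: continuous_compact_integrable; first exact: segment_compact.
apply: continuous_in_subspaceT => t; rewrite inE/= in_itv/= => t01.
exact: cf.
Qed.

Lemma cont01D f g : cont01 f -> cont01 g -> cont01 (fun t => f t + g t).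
Proof. by move=> cf cg t t01; apply: cvgD; [exact: cf|exact: cg]. Qed.

Lemma cont01Z f (a : R) : cont01 f -> cont01 (fun t => a * f t).
Proof. by move=> cf t t01; apply: cvgM; [exact: cvg_cst|exact: cf]. Qed.

Lemma cont01_sum n (f : 'I_n -> R -> R) : (forall i, cont01 (f i)) ->
  cont01 (fun t => \sum_i f i t).
Proof.
move=> cf t t01; apply: cvg_big => [|i _]; [exact: add_continuous|exact: cf].
Qed.

Lemma meanD f g : cont01 f -> cont01 g ->
  mean (fun t => f t + g t) = mean f + mean g.
Proof. by move=> cf cg; rewrite /mean RintegralD//; exact: cont01_integrable. Qed.

Lemma meanZ f (a : R) : cont01 f -> mean (fun t => a * f t) = a * mean f.
Proof. by move=> cf; rewrite /mean RintegralZl//; exact: cont01_integrable. Qed.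

Lemma mean_cst (a : R) : mean (fun=> a) = a.
Proof.
rewrite /mean Rintegral_cst//= lebesgue_measure_itv/= lte_fin ltr01.
by rewrite oppr0 adde0 mulr1.
Qed.

Lemma mean_sum n (f : 'I_n -> R -> R) : (forall i, cont01 (f i)) ->
  mean (fun t => \sum_i f i t) = \sum_i mean (f i).
Proof.
elim: n f => [|n IH] f cf.
  under eq_fun do rewrite big_ord0.
  by rewrite mean_cst big_ord0.
under eq_fun do rewrite big_ord_recl.
rewrite meanD// ?big_ord_recl ?IH//.
by apply: cont01_sum => i; exact: cf.
Qed.

Lemma mean_norm_le f (M : R) : cont01 f ->
  (forall t, 0 <= t <= 1 -> `|f t| <= M) -> `|mean f| <= M.
Proof.
move=> cf fM; have If := cont01_integrable cf.
have cM (a : R) : cont01 (fun=> a) by move=> t _; exact: cvg_cst.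
rewrite ler_norml -(mean_cst M) -(mean_cst (- mean (fun=> M))) /mean.
rewrite !le_Rintegral//; try exact: cont01_integrable.
  move=> t; rewrite /= in_itv/= => t01.
  by move: (fM t t01); rewrite ler_norml => /andP[].
move=> t; rewrite /= in_itv/= => t01; rewrite -/(mean (fun=> M)) mean_cst.
by move: (fM t t01); rewrite ler_norml => /andP[].
Qed.

Lemma mean_derive (F f : R -> R) : cont01 f ->
  (forall t : R, 0 <= t <= 1 -> is_derive t 1 F (f t)) ->
  mean f = F 1 - F 0.
Proof.
move=> cf dF; have cF t : 0 <= t <= 1 -> {for t, continuous F}.
  move=> t01; have [dFt _] := dF t t01.
  exact/differentiable_continuous/derivable1_diffP.
have oc (t : R) : t \in `]0, 1[ -> 0 <= t <= 1.
  by rewrite in_itv/= => /andP[? ?]; rewrite !ltW.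
rewrite /mean /Rintegral (@continuous_FTC2 _ f F 0 1)//.
- apply: continuous_in_subspaceT => t; rewrite inE/= in_itv/= => t01.
  exact: cf.
- split.
  + by move=> t /oc/dF[].
  + by apply: cvg_at_right_filter; apply: cF; rewrite lexx ler01.
  + by apply: cvg_at_left_filter; apply: cF; rewrite lexx ler01.
- by move=> t /oc/dF[_ <-]; rewrite derive1E.
Qed.

End Mean.

Section Hadamard.
Context {R : realType} {n : nat}.
Variables (U : set 'rV[R]_n) (r : R).
Hypothesis r0 : 0 < r.
Hypothesis (rU : forall x : 'rV[R]_n, `|x| <= r -> U x).
Implicit Types (f : 'rV[R]_n -> R).

(** Closed balls of [U] are compact: this is where finite dimension enters. *)
Lemma bounded_on_ball f : (forall x, U x -> {for x, continuous f}) ->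
  exists2 M : R, 0 <= M & forall x, `|x| <= r -> `|f x| <= M.
Proof.
move=> cf; pose B := [set x : 'rV[R]_n | `|x| <= r].
have Bc : compact B.
  apply: bounded_closed_compact.
    by exists r; split => [|M rM x xr]; [exact: num_real|exact: le_trans xr (ltW rM)].
  have := @closed_closed_ball_ R _ (0 : 'rV[R]_n) r.
  by rewrite /closed_ball_/=; under eq_set do rewrite sub0r normrN.
have [|||c _ fc] := @EVT_max_rV R n (fun x => `|f x|) B.
- by exists 0; rewrite /B/= normr0 ltW.
- exact: Bc.
- apply: continuous_in_subspaceT => x; rewrite inE => /rU Ux.
  exact: (cvg_norm (cf x Ux)).
exists `|f c| => // x xr; apply: fc; rewrite inE; exact: xr.
Qed.

Lemma lipschitz_on_ball f : C_on 1 U f ->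
  exists2 K : R, 0 <= K &
    forall x y : 'rV[R]_n, `|x| <= r -> `|y| <= r -> `|f y - f x| <= K * `|y - x|.
Proof.
move=> [df cDf].
have /boolp.choice[M M0] j : exists M : R, 0 <= M /\
    forall x : 'rV[R]_n, `|x| <= r -> `|'D_(delta_mx 0 j) f x| <= M.
  by have [M M0 fM] := bounded_on_ball (cDf (delta_mx 0 j)); exists M.
exists (\sum_j M j); first by apply: sumr_ge0 => j _; have [] := M0 j.
move=> x y xr yr.
have seg (t : R) : 0 <= t <= 1 -> `|x + t *: (y - x)| <= r.
  move=> /andP[t0 t1].
  rewrite scalerBr addrCA -{1}(scale1r x) -scalerBl addrC.
  rewrite (le_trans (ler_normD _ _))// !normrZ (ger0_norm t0) ger0_norm ?subr_ge0//.
  rewrite [leRHS](_ : _ = (1 - t) * r + t * r); last by ring.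
  by rewrite lerD// ler_wpM2l// subr_ge0.
have [|t t01] := @line_MVT R _ f x (y - x) 1.
  by move=> t t01; rewrite mulr1; apply: diff_derivable; apply: df; exact/rU/seg.
rewrite scale1r subrKC mul1r mulr1 => ->.
rewrite derive_row; last exact/df/rU/seg.
rewrite mulr_suml (le_trans (ler_norm_sum _ _ _))//; apply: ler_sum => j _.
rewrite normrM mulrC ler_pM ?coord_le_norm//.
by apply: (M0 j).2; exact: seg.
Qed.

(** The weight [t ^+ k] keeps this family of operators closed under
    differentiation: each derivative in [x] produces one factor [t]. *)
Definition ray_mean (k : nat) f (x : 'rV[R]_n) : R :=
  mean (fun t => t ^+ k * f (t *: x)).

Lemma ray_in (t : R) (x : 'rV[R]_n) : 0 <= t <= 1 -> `|x| <= r -> `|t *: x| <= r.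
Proof.
by move=> /andP[t0 t1]; apply: le_trans; rewrite normrZ ger0_norm// ler_piMl.
Qed.

Lemma cont01_ray k f x : (forall x, U x -> {for x, continuous f}) ->
  `|x| <= r -> cont01 (fun t => t ^+ k * f (t *: x)).
Proof.
move=> cf xr t t01; apply: cvgM; first exact: exprn_continuous.
have cZ : {for t, continuous (fun t : R => t *: x)} by exact: scalel_continuous.
by apply: (continuous_comp cZ); apply: cf; exact/rU/ray_in.
Qed.

(** Differentiation under the integral sign. The partial derivatives of [f] are
    Lipschitz on the ball, so that the error in the first order expansion of
    [f (t *: (h + x))] is at most a constant times the square of [`|h|],
    uniformly in [t], and this bound survives integration. *)
Lemma ray_mean_diff k f x : (forall m, C_on m U f) -> `|x| < r ->
  differentiable (ray_mean k f) x /\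
  forall v, 'D_v (ray_mean k f) x =
    \sum_j v 0 j * ray_mean k.+1 ('D_(delta_mx 0 j) f) x.
Proof.
move=> Cf xr; have cf := C_on_continuous (Cf 0%N).
have [df _] := Cf 1%N.
have CDf j m : C_on m U ('D_(delta_mx 0 j) f) by have [_] := Cf m.+1; apply.
have cDf j := C_on_continuous (CDf j 0%N).
have Llin : linear (fun h : 'rV[R]_n =>
    \sum_j h 0 j * ray_mean k.+1 ('D_(delta_mx 0 j) f) x).
  move=> a u v; rewrite scaler_sumr -big_split/=; apply: eq_bigr => j _.
  by rewrite !mxE mulrDl scalerAl.
pose LM := GRing.isLinear.Build _ _ _ _ _ Llin.
pose L : {linear 'rV[R]_n -> R} := HB.pack (fun h : 'rV[R]_n =>
    \sum_j h 0 j * ray_mean k.+1 ('D_(delta_mx 0 j) f) x) LM.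
have cL : continuous L.
  move=> h; apply: smooth_at_continuous; apply: smooth_at_sum => j _.
  by apply: smooth_atM; [exact: smooth_at_coord|exact: smooth_at_cst].
suff [dm dmE] : differentiable (ray_mean k f) x /\
    'd (ray_mean k f) x = L :> (_ -> _).
  by split => // v; rewrite deriveE// dmE.
apply: eps_is_diff => // e e0.
have [K K0 HK] : exists2 K : R, 0 <= K & forall j (y z : 'rV[R]_n),
    `|y| <= r -> `|z| <= r ->
    `|'D_(delta_mx 0 j) f z - 'D_(delta_mx 0 j) f y| <= K * `|z - y|.
  have /boolp.choice[K HK] j : exists K : R, 0 <= K /\ forall y z : 'rV[R]_n,
      `|y| <= r -> `|z| <= r ->
      `|'D_(delta_mx 0 j) f z - 'D_(delta_mx 0 j) f y| <= K * `|z - y|.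
    by have [K K0 HK] := lipschitz_on_ball (CDf j 1%N); exists K.
  exists (\sum_j K j); first by apply: sumr_ge0 => j _; have [] := HK j.
  move=> j y z yr zr; apply: le_trans ((HK j).2 y z yr zr) _.
  rewrite ler_wpM2r// (bigD1 j)//= lerDl sumr_ge0// => i _.
  by have [] := HK i.
have nK0 : 0 <= n%:R * K by rewrite mulr_ge0.
have xr0 : 0 < r - `|x| by rewrite subr_gt0.
have small (d : R) : 0 < d -> \forall h \near (0 : 'rV[R]_n), `|h| < d.
  move=> d0; apply/nbhs_ballP; exists d => // y.
  by rewrite -ball_normE/= sub0r normrN.
have e'0 : 0 < e / (n%:R * K + 1) by rewrite divr_gt0// ltr_wpDl.
near=> h.
have hr : `|h| < r - `|x| by near: h; exact: small.
have he : n%:R * K * `|h| <= e.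
  have : `|h| < e / (n%:R * K + 1) by near: h; exact: small.
  rewrite ltr_pdivlMr ?ltr_wpDl// mulrC mulrDl mul1r => /ltW.
  by apply: le_trans; rewrite lerDl.
have xr' : `|x| <= r by rewrite ltW.
have hxr : `|h + x| <= r.
  by rewrite (le_trans (ler_normD _ _))// -lerBrDr ltW.
have c1 := cont01_ray (k := k) cf hxr.
have c2 := cont01Z (a := -1) (cont01_ray (k := k) cf xr').
have c3 j := cont01Z (a := - h 0 j) (cont01_ray (k := k.+1) (cDf j) xr').
have c4 := cont01_sum c3.
(* the integrand of the error of the first order expansion *)
pose phi t := t ^+ k * f (t *: (h + x)) + (-1 * (t ^+ k * f (t *: x)) +
  \sum_j - h 0 j * (t ^+ k.+1 * 'D_(delta_mx 0 j) f (t *: x))).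
have -> : ray_mean k f (h + x) - ray_mean k f x - L h = mean phi.
  rewrite /phi (meanD c1 (cont01D c2 c4)) (meanD c2 c4) mean_sum//.
  rewrite (meanZ _ (cont01_ray (k := k) cf xr')) mulN1r addrA; congr (_ + _).
  rewrite /L/= -sumrN; apply: eq_bigr => j _.
  by rewrite (meanZ _ (cont01_ray (k := k.+1) (cDf j) xr')) mulNr.
apply: mean_norm_le; first exact: (cont01D c1 (cont01D c2 c4)).
move=> t t01; have /andP[t0 t1] := t01.
have inB (u : R) : 0 <= u <= 1 -> `|t *: x + u *: (t *: h)| <= r.
  move=> u01; rewrite scalerA mulrC -scalerA -scalerDr; apply: ray_in => //.
  move/andP: u01 => [u0 u1].
  rewrite (le_trans (ler_normD _ _))// addrC -lerBrDr (le_trans _ (ltW hr))//.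
  by rewrite normrZ ger0_norm// ler_piMl.
have [|u u01] := @line_MVT R _ f (t *: x) (t *: h) 1.
  by move=> u u01; rewrite mulr1; apply: diff_derivable; apply: df; exact/rU/inB.
rewrite scale1r mul1r mulr1 derive_row; last exact/df/rU/inB.
set y := t *: x + u *: _ => fE.
have -> : phi t = \sum_j (t ^+ k.+1 * h 0 j) *
    ('D_(delta_mx 0 j) f y - 'D_(delta_mx 0 j) f (t *: x)).
  rewrite /phi scalerDr addrC -addrA.
  have -> : f (t *: h + t *: x) = f (t *: x) +
      \sum_(j < n) (t *: h) 0 j * 'D_(delta_mx 0 j) f y by rewrite -fE addrC subrKC.
  rewrite mulrDr mulr_sumr mulN1r addrCA addKr -big_split/=.
  by apply: eq_bigr => j _; rewrite !mxE exprSr; ring.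
rewrite (le_trans (ler_norm_sum _ _ _))// (@le_trans _ _ (\sum_(j < n) `|h| * (K * `|h|)))//.
  apply: ler_sum => j _; rewrite normrM ler_pM//.
    rewrite normrM (le_trans _ (coord_le_norm h j))// ler_piMl// normrX.
    by rewrite exprn_ile1// ger0_norm.
  rewrite (le_trans (HK j _ _ (ray_in t01 xr') (inB u u01)))// ler_wpM2l//.
  rewrite /y addrC addKr !normrZ; move/andP: u01 => [u0 u1].
  by rewrite !ger0_norm// mulrA ler_piMl// mulr_ile1.
rewrite sumr_const card_ord -mulr_natl mulrCA mulrC; apply: le_trans (_ : (n%:R * K * `|h|) * `|h| <= _).
  by rewrite !mulrA.
by rewrite ler_wpM2r.
Unshelve. all: by end_near. Qed.

Lemma ball0_open : open [set x : 'rV[R]_n | `|x| < r].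
Proof.
have -> : [set x : 'rV[R]_n | `|x| < r] = ball 0 r.
  by apply/seteqP; split => x; rewrite -ball_normE/= sub0r normrN.
exact: ball_open.
Qed.

Lemma ray_mean_C_on m k f : (forall m, C_on m U f) ->
  C_on m [set x : 'rV[R]_n | `|x| < r] (ray_mean k f).
Proof.
elim: m k f => [|m IH] k f Cf.
  move=> x xr; apply: differentiable_continuous.
  by have [] := ray_mean_diff k Cf xr.
split=> [x xr|v]; first by have [] := ray_mean_diff k Cf xr.
apply: (@eq_C_on _ _ _ _ (fun x =>
  \sum_j v 0 j * ray_mean k.+1 ('D_(delta_mx 0 j) f) x)); first exact: ball0_open.
  by move=> x xr; have [_ ->] := ray_mean_diff k Cf xr.
apply: C_on_sum => [|j _]; first exact: ball0_open.
apply: C_onM; [exact: ball0_open|exact: C_on_cst|apply: IH => m'].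
by have [_] := Cf m'.+1; apply.
Qed.

Lemma ray_mean_expand f : (forall m, C_on m U f) -> f 0 = 0 ->
  forall x, `|x| < r -> f x = \sum_j x 0 j * ray_mean 0 ('D_(delta_mx 0 j) f) x.
Proof.
move=> Cf f0 x xr; have [df _] := Cf 1%N.
have xr' : `|x| <= r by rewrite ltW.
have cDf j : forall x, U x -> {for x, continuous ('D_(delta_mx 0 j) f)}.
  by apply: C_on_continuous (_ : C_on 0 U _); have [_] := Cf 1%N; apply.
have c3 j := cont01Z (a := x 0 j) (cont01_ray (k := 0%N) (cDf j) xr').
have -> : f x = f (1 *: x) - f (0 *: x) by rewrite scale1r scale0r f0 subr0.
transitivity (mean (fun t =>
    \sum_j x 0 j * (t ^+ 0 * 'D_(delta_mx 0 j) f (t *: x)))); last first.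
  rewrite mean_sum//; apply: eq_bigr => j _.
  by rewrite (meanZ _ (cont01_ray (k := 0%N) (cDf j) xr')).
symmetry; apply: (@mean_derive R (fun t => f (t *: x))); first exact: cont01_sum.
move=> t t01; have dft : differentiable f (t *: x) by exact/df/rU/ray_in.
  have dx : is_derive t 1 (fun t : R => t *: x) x.
    apply: DeriveDef; first by apply: diff_derivable; exact: ex_diff.
    by rewrite deriveE; [rewrite diff_val/= scale1r|exact: ex_diff].
  have dZ : differentiable (fun t : R => t *: x) t by exact: ex_diff.
  apply: DeriveDef; first exact/diff_derivable/(differentiable_comp dZ dft).
  rewrite deriveE; last exact: (differentiable_comp dZ dft).
  rewrite (diff_comp dZ dft)/= -(deriveE _ dZ) derive_val -(deriveE _ dft).
  by rewrite derive_row//; apply: eq_bigr => j _; rewrite mul1r.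
Qed.

End Hadamard.

(** A smooth function vanishing at the origin is the integral over [t] of the
    derivative of [f (t *: x)], in which the coordinates of [x] factor out. *)
Lemma hadamard (R : realType) n (f : 'rV[R]_n -> R) : smooth_at 0 f -> f 0 = 0 ->
  exists2 G : 'I_n -> 'rV[R]_n -> R, forall j, smooth_at 0 (G j) &
    \forall x \near (0 : 'rV[R]_n), f x = \sum_j x 0 j * G j x.
Proof.
move=> [U [oU U0] Cf] f0.
have /nbhs_ballP[d /= d0 dU] : nbhs 0 U by exact: open_nbhs_nbhs.
(* half the radius, so that the closed ball still lies in [U] *)
pose r := d / 2; have r0 : 0 < r by rewrite divr_gt0.
have rU (x : 'rV[R]_n) : `|x| <= r -> U x.
  move=> xr; apply: dU; rewrite -ball_normE/= sub0r normrN (le_lt_trans xr)//.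
  by rewrite ltr_pdivrMr// ltr_pMr// ltr1n.
have oB := @ball0_open R n r.
pose G (j : 'I_n) := ray_mean 0%N ('D_(delta_mx 0 j) f).
exists G.
  move=> j; exists [set x : 'rV[R]_n | `|x| < r].
    by split => //=; rewrite normr0.
  move=> m; apply: (ray_mean_C_on r0 rU) => m'.
  by have [_] := Cf m'.+1; apply.
apply: (@open_near _ _ _ 0 _ oB); first by rewrite /= normr0.
exact: (ray_mean_expand rU Cf f0).
Qed.

(** * A smooth implicit fixed point theorem *)

(** Banach's theorem asks for a complete normed space; the completeness of
    matrices is known for their uniform structure, and this instance joins it
    with the norm. *)
HB.instance Definition _ (R : realType) (m n : nat) :=
  Uniform_isComplete.Build 'M[R]_(m, n) (@mx_complete R m n).

Section MatrixSmoothness.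
Context {R : realType} {V : normedModType R}.
Implicit Types (U : set V).

Lemma C_on_det m n U (A : V -> 'M[R]_n) : open U ->
  (forall i j, C_on m U (fun x => A x i j)) -> C_on m U (fun x => \det (A x)).
Proof.
move=> oU CA; apply: C_on_sum => // s _; apply: C_onM => //.
  exact: C_on_cst.
by apply: C_on_prod => // i _.
Qed.

(** Cramer's rule: the entries of the inverse are rational functions of the
    entries of the matrix. *)
Lemma C_on_invmx m n U (A : V -> 'M[R]_n) : open U ->
  (forall x, U x -> A x \in unitmx) ->
  (forall i j, C_on m U (fun x => A x i j)) ->
  forall i j, C_on m U (fun x => invmx (A x) i j).
Proof.
move=> oU uA CA i j.
apply: (@eq_C_on _ _ _ _ (fun x => (\det (A x))^-1 * (\adj (A x)) i j)) => //.
  by move=> x Ux; rewrite /invmx uA// !mxE.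
apply: C_onM => //.
  apply: C_onV => //; last exact: C_on_det.
  by move=> x /uA; rewrite unitmxE unitfE.
under eq_fun do rewrite mxE /cofactor.
apply: C_onM => //; first exact: C_on_cst.
apply: C_on_det => // k l.
by under eq_fun do rewrite !mxE.
Qed.

End MatrixSmoothness.

Section RowBlocks.
Context {R : realType} {p n : nat}.
Implicit Types (x : 'rV[R]_p) (w : 'rV[R]_n).

(** The pair [(x, w)] as a row of functions, the form that [C_on_comp] expects. *)
Definition row_mx_entry x w (j : 'I_(p + n)) : R :=
  match fintype.split j with inl k => x 0 k | inr k => w 0 k end.

Lemma row_mx_entryE x w : row_mx x w = \row_j row_mx_entry x w j.
Proof. by apply/rowP => j; rewrite !mxE. Qed.

Lemma row_mx_norm_lt x w (M : R) : `|x| < M -> `|w| < M -> `|row_mx x w| < M.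
Proof.
move=> xM wM; apply: row_norm_lt => [|j]; first exact: le_lt_trans xM.
rewrite row_mx_entryE mxE /row_mx_entry; case: fintype.split => k.
  exact: le_lt_trans (coord_le_norm _ _) xM.
exact: le_lt_trans (coord_le_norm _ _) wM.
Qed.

Lemma row_mx_norm_le x w : `|row_mx x w| <= `|x| + `|w|.
Proof.
apply: row_norm_le => [|j]; first exact: addr_ge0.
rewrite row_mx_entryE mxE /row_mx_entry; case: fintype.split => k.
  by rewrite (le_trans (coord_le_norm _ _))// lerDl.
by rewrite (le_trans (coord_le_norm _ _))// lerDr.
Qed.

Lemma linear_row_continuous (W : normedModType R) (f : {linear 'rV[R]_p -> W}) :
  continuous f.
Proof.
have fE : (f : 'rV[R]_p -> W) =
    \sum_(j < p) (fun y : 'rV[R]_p => y 0 j *: f (delta_mx 0 j)).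
  apply/funext => y; rewrite {1}(row_sum_delta y) linear_sum fct_sumE.
  by apply: eq_bigr => j _; rewrite linearZ.
move=> x; apply: differentiable_continuous; rewrite fE.
by apply: differentiable_sum => j; apply: differentiableZl; exact: differentiable_coord.
Qed.

Lemma segment_norm_le (V : normedModType R) (c y z : V) (d t : R) :
  0 <= t <= 1 -> `|y - c| < d -> `|z - c| < d -> `|y + t *: (z - y) - c| < d.
Proof.
move=> /andP[t0 t1] yd zd.
have -> : y + t *: (z - y) - c = (1 - t) *: (y - c) + t *: (z - c).
  have -> : z - c = (z - y) + (y - c) by rewrite addrA subrK.
  by rewrite [X in _ = _ + X]scalerDr addrCA -scalerDl subrK scale1r addrAC addrC.
have [->|t10] := eqVneq t 1; first by rewrite subrr scale0r add0r scale1r.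
rewrite (le_lt_trans (ler_normD _ _))// !normrZ (ger0_norm t0) ger0_norm ?subr_ge0//.
rewrite [ltRHS](_ : _ = (1 - t) * d + t * d); last by ring.
rewrite ltr_leD// ?ler_wpM2l ?(ltW zd)// ltr_pM2l// subr_gt0.
by rewrite lt_neqAle t10.
Qed.

End RowBlocks.

Section FixedPoint.
Context {R : realType} {p n : nat}.
Variables (T : 'I_n -> 'rV[R]_(p + n) -> R) (a : 'rV[R]_p) (v0 : 'rV[R]_n).
Hypothesis Tsmooth : forall i, smooth_at (row_mx a v0) (T i).
Hypothesis DTv0 : forall i j,
  'D_(row_mx 0 (delta_mx 0 j)) (T i) (row_mx a v0) = 0.

Let TT (y : 'rV[R]_(p + n)) : 'rV[R]_n := \row_i T i y.

Lemma row_mx_diff (f : 'rV[R]_(p + n) -> R) y (u : 'rV[R]_n) :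
  differentiable f y ->
  'D_(row_mx 0 u) f y = \sum_j u 0 j * 'D_(row_mx 0 (delta_mx 0 j)) f y.
Proof.
move=> df; rewrite deriveE// {1}(row_sum_delta u).
have -> : row_mx 0 (\sum_j u 0 j *: delta_mx 0 j) =
    \sum_j u 0 j *: row_mx (0 : 'rV[R]_p) (delta_mx 0 j).
  by rewrite -[RHS]hsubmxK !linear_sum/=; congr row_mx; [rewrite big1// => j _|
    apply: eq_bigr => j _]; rewrite linearZ/= ?row_mxKl ?row_mxKr ?scaler0.
by rewrite linear_sum; apply: eq_bigr => j _; rewrite linearZ deriveE.
Qed.

Lemma near_row_mx (P : 'rV[R]_(p + n) -> Prop) :
  (\forall y \near row_mx a v0, P y) ->
  exists2 d : R, 0 < d & forall x w, `|x - a| < d -> `|w - v0| < d ->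
    P (row_mx x w).
Proof.
move=> /nbhs_ballP[d /= d0 dP]; exists d => // x w xd wd; apply: dP.
rewrite -ball_normE/= opp_row_mx add_row_mx.
by apply: row_mx_norm_lt; rewrite distrC.
Qed.

(** The derivative in the unknown vanishes at the base point, hence is small
    around it, uniformly in the parameter; by the mean value theorem [T] is then
    a contraction in the unknown. *)
Lemma half_contraction : exists2 d : R, 0 < d &
  [/\ exists2 U, open U & (forall x w, `|x - a| < d -> `|w - v0| < d ->
        U (row_mx x w)) /\ forall i m, C_on m U (T i),
      forall x w u i, `|x - a| < d -> `|w - v0| < d ->
        `|'D_(row_mx 0 u) (T i) (row_mx x w)| <= `|u| / 2 &
      forall x w w', `|x - a| < d -> `|w - v0| < d -> `|w' - v0| < d ->
        `|TT (row_mx x w') - TT (row_mx x w)| <= `|w' - w| / 2].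
Proof.
have [U [oU Ua] CU] := smooth_at_common Tsmooth.
(* [n] coordinates, each contributing at most [e], must add up to at most 1/2 *)
pose e : R := (n.+1%:R * 2)^-1; have e0 : 0 < e by rewrite invr_gt0 mulr_gt0.
have /near_row_mx[d d0 dP] : \forall y \near row_mx a v0, U y /\
    forall i j, `|'D_(row_mx 0 (delta_mx 0 j)) (T i) y| <= e.
  near=> y; split; first by near: y; exact: open_nbhs_nbhs.
  near: y; apply: filter_forall => i; apply: filter_forall => j.
  have sD := smooth_at_derive (row_mx 0 (delta_mx 0 j)) (Tsmooth i).
  have /cvgrPdist_le/(_ e e0) := smooth_at_continuous sD.
  by rewrite DTv0; apply: filterS => y; rewrite sub0r normrN.
have dT i x w : `|x - a| < d -> `|w - v0| < d -> differentiable (T i) (row_mx x w).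
  move=> xd wd; have [+ _] := CU i 1%N; apply.
  exact: (dP x w xd wd).1.
have DT x w u i : `|x - a| < d -> `|w - v0| < d ->
    `|'D_(row_mx 0 u) (T i) (row_mx x w)| <= `|u| / 2.
  move=> xd wd; rewrite row_mx_diff; last exact: dT.
  rewrite (le_trans (ler_norm_sum _ _ _))//.
  apply: (@le_trans _ _ (\sum_(j < n) `|u| * e)).
    apply: ler_sum => j _; rewrite normrM ler_pM ?coord_le_norm//.
    exact: (dP x w xd wd).2.
  rewrite sumr_const card_ord -(mulr_natl _ n) mulrCA ler_wpM2l//.
  rewrite /e invfM mulrA -[leRHS]mul1r ler_wpM2r//.
  by rewrite ler_pdivrMr// mul1r ler_nat.
exists d => //; split => //.
  by exists U => //; split => // x w xd /(dP x w xd)[].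
move=> x w w' xd wd w'd; apply: row_norm_le => [|i]; first by rewrite divr_ge0.
rewrite !mxE.
have seg (t : R) : row_mx x w + t *: row_mx 0 (w' - w) =
    row_mx x (w + t *: (w' - w)).
  by rewrite scale_row_mx add_row_mx scaler0 addr0.
have segd (t : R) : 0 <= t <= 1 -> `|w + t *: (w' - w) - v0| < d.
  by move=> t01; exact: segment_norm_le.
have [|t t01] := @line_MVT R _ (T i) (row_mx x w) (row_mx 0 (w' - w)) 1.
  move=> t t01; rewrite mulr1 seg; apply: diff_derivable.
  by apply: dT => //; exact: segd.
rewrite mulr1 mul1r scale1r add_row_mx addr0 subrKC seg => ->.
by apply: DT => //; exact: segd.
Unshelve. all: by end_near. Qed.

End FixedPoint.

Section FixedPointDerivative.
Context {R : realType} {p n : nat}.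
Variables (F : 'rV[R]_(p + n) -> 'rV[R]_n) (v : 'rV[R]_p -> 'rV[R]_n).
Variable (x : 'rV[R]_p).
Let y := row_mx x (v x).
Hypothesis dF : differentiable F y.
Hypothesis dF2 : forall u, `|'d F y (row_mx 0 u)| <= `|u| / 2.
Hypothesis cv : {for x, continuous v}.
Hypothesis vF : \forall x' \near x, v x' = F (row_mx x' (v x')).

(** The matrix of the identity minus the derivative of [F] in the unknown, which
    is invertible because that derivative has norm at most 1/2. Differentiating
    [v x = F (x, v x)] gives the derivative of [v] as the derivative of [F] in the
    parameter times the inverse of this matrix. *)
Definition residual_mx : 'M[R]_n :=
  \matrix_(k, j) ((k == j)%:R - 'd F y (row_mx 0 (delta_mx 0 k)) 0 j).

Lemma residual_mxE u : u *m residual_mx = u - 'd F y (row_mx 0 u).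
Proof.
apply/rowP => j; rewrite !mxE [in X in _ - 'd F y X _ _](row_sum_delta u).
have -> : row_mx 0 (\sum_k u 0 k *: delta_mx 0 k) =
    \sum_k u 0 k *: row_mx (0 : 'rV[R]_p) (delta_mx 0 k).
  by rewrite -[RHS]hsubmxK !linear_sum/=; congr row_mx; [rewrite big1// => k _|
    apply: eq_bigr => k _]; rewrite linearZ/= ?row_mxKl ?row_mxKr ?scaler0.
rewrite linear_sum summxE.
under eq_bigr do rewrite mxE mulrBr.
rewrite sumrB; congr (_ - _).
  rewrite (bigD1 j)//= eqxx mulr1 big1 ?addr0// => k /negbTE->.
  by rewrite mulr0.
by apply: eq_bigr => k _; rewrite linearZ mxE.
Qed.

Lemma residual_unitmx : residual_mx \in unitmx.
Proof.
rewrite -row_free_unit; apply: inj_row_free => u.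
rewrite residual_mxE => /subr0_eq uE; apply/eqP; rewrite -normr_le0.
by have := dF2 u; rewrite -uE; have := normr_ge0 u; lra.
Qed.

(** Here [v] is known to be continuous only. Put [delta] for its increment and
    [L h] for the candidate differential. The expansion of [F] bounds
    [delta - L h] by [`|delta - L h| / 2], which is moved to the other side,
    plus a small multiple of [`|h| + `|delta|]; and [`|delta|] is in turn at
    most [`|delta - L h|] plus a multiple of [`|h|]. *)
Lemma fixed_point_diff : differentiable v x /\
  forall h, 'd v x h = 'd F y (row_mx h 0) *m invmx residual_mx.
Proof.
have Llin : linear (fun h : 'rV[R]_p => 'd F y (row_mx h 0) *m invmx residual_mx).
  move=> c h h'; have -> : row_mx (c *: h + h') 0 =
      c *: row_mx h 0 + row_mx h' (0 : 'rV[R]_n).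
    by rewrite scale_row_mx scaler0 add_row_mx addr0.
  by rewrite linearP mulmxDl scalemxAl.
pose LM := GRing.isLinear.Build _ _ _ _ _ Llin.
pose L : {linear 'rV[R]_p -> 'rV[R]_n} := HB.pack
  (fun h : 'rV[R]_p => 'd F y (row_mx h 0) *m invmx residual_mx) LM.
have cL : continuous L by exact: linear_row_continuous.
suff [dv dvE] : differentiable v x /\ 'd v x = L :> (_ -> _).
  by split => // h; rewrite dvE.
have LE h : L h = 'd F y (row_mx h 0) + 'd F y (row_mx 0 (L h)).
  apply/eqP; rewrite -subr_eq -residual_mxE /L/= mulmxKV//.
  exact: residual_unitmx.
have [C C0 LC] := linear_lipschitz cL.
apply: eps_is_diff => // e e0.
(* The bound 1/4 lets half of the left-hand side absorb the occurrence of
   [`|delta - L h|] on the right; the other one leaves at most [e * `|h|]. *)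
pose e1 : R := Num.min (4^-1) (e / (4 * (1 + C))).
have C1 : 0 < 4 * (1 + C) by rewrite mulr_gt0// addr_gt0.
have e10 : 0 < e1 by rewrite lt_min invr_gt0 divr_gt0 ?andbT// ltr0n.
have : \forall h \near (0 : 'rV[R]_p), let k := row_mx h (v (h + x) - v x) in
    `|F (k + y) - F y - 'd F y k| <= e1 * `|k|.
  have /nbhs_ballP[d /= d0 dP] := differentiable_eps dF e10.
  have cv0 : \forall h \near (0 : 'rV[R]_p), `|v x - v (h + x)| < d.
    have : \forall z \near x, `|v x - v z| < d.
      by have /cvgrPdist_lt := cv; apply.
    by rewrite (near_shift 0 x) /= subr0.
  near=> h; apply: dP; rewrite -ball_normE/= sub0r normrN.
  apply: row_mx_norm_lt; last by rewrite distrC; near: h.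
  near: h; apply/nbhs_ballP; exists d => // h.
  by rewrite -ball_normE/= sub0r normrN.
have : \forall h \near (0 : 'rV[R]_p), v (h + x) = F (row_mx (h + x) (v (h + x))).
  by move: vF; rewrite (near_shift 0 x) /= subr0.
have kyE h : row_mx h (v (h + x) - v x) + y = row_mx (h + x) (v (h + x)).
  by rewrite /y add_row_mx subrK.
have Fy : F y = v x by rewrite /y -(nbhs_singleton vF).
apply: filterS2 => h; rewrite /= kyE Fy => <- Hk.
set delta := v (h + x) - v x in Hk *.
have {}Hk := le_trans Hk (ler_wpM2l (ltW e10) (row_mx_norm_le _ _)).
have dk : 'd F y (row_mx h delta) = 'd F y (row_mx h 0) + 'd F y (row_mx 0 delta).
  by rewrite -linearD add_row_mx addr0 add0r.
have eE : delta - L h = (delta - 'd F y (row_mx h delta)) +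
    'd F y (row_mx 0 (delta - L h)).
  rewrite {1}LE dk; have -> : row_mx 0 (delta - L h) =
      row_mx 0 delta - row_mx (0 : 'rV[R]_p) (L h).
    by rewrite opp_row_mx add_row_mx subr0.
  by rewrite linearB !opprD -!addrA addKr.
have Hd : `|delta| <= `|delta - L h| + C * `|h|.
  rewrite -{1}(subrK (L h) delta) (le_trans (ler_normD _ _))//.
  by rewrite lerD2l.
have He : `|delta - L h| <= `|delta - 'd F y (row_mx h delta)| +
    `|delta - L h| / 2.
  rewrite {1}eE (le_trans (ler_normD _ _))// lerD2l.
  exact: dF2.
have e1l : e1 <= 4^-1 by rewrite ge_min lexx.
have e1r : e1 * (4 * (1 + C)) <= e.
  by rewrite -ler_pdivlMr// ge_min lexx orbT.
have n1 := normr_ge0 h; have n2 := normr_ge0 (delta - L h).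
have H1 : e1 * `|delta| <= e1 * (`|delta - L h| + C * `|h|) by rewrite ler_wpM2l// ltW.
have H2 : e1 * `|delta - L h| <= 4^-1 * `|delta - L h| by rewrite ler_wpM2r.
have H3 : e1 * (4 * (1 + C)) * `|h| <= e * `|h| by rewrite ler_wpM2r.
move: Hk He H1 H2 H3; rewrite !mulrDr; lra.
Unshelve. all: by end_near. Qed.

End FixedPointDerivative.

(** Banach's theorem with a parameter. The contraction property gives existence,
    uniqueness and continuity of the fixed point [v x], and [fixed_point_diff]
    its differentiability at every point of a common neighbourhood. The formula
    for its derivative involves derivatives of [T] at [(x, v x)] and the inverse
    of a matrix of such derivatives, so that it is as regular as [v] itself:
    smoothness follows by bootstrapping. *)
Theorem smooth_fixed_point (R : realType) p n
    (T : 'I_n -> 'rV[R]_(p + n) -> R) (a : 'rV[R]_p) (v0 : 'rV[R]_n) :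
  (forall i, smooth_at (row_mx a v0) (T i)) ->
  (forall i, T i (row_mx a v0) = v0 0 i) ->
  (forall i j, 'D_(row_mx 0 (delta_mx 0 j)) (T i) (row_mx a v0) = 0) ->
  exists v : 'rV[R]_p -> 'rV[R]_n,
    [/\ v a = v0, forall i, smooth_at a (fun x => v x 0 i),
        \forall x \near a, v x = \row_i T i (row_mx x (v x)) &
        exists2 r : R, 0 < r & \forall x \near a, forall w, `|w - v0| < r ->
          w = \row_i T i (row_mx x w) -> w = v x].
Proof.
move=> Tsmooth Tv0 DTv0.
pose F y := \row_i T i y.
have [d d0 [[U oU [inU CU]] DT ctr]] := half_contraction Tsmooth DTv0.
have d20 : 0 < d / 2 by rewrite divr_gt0.
have d2d : d / 2 < d by rewrite ltr_pdivrMr// ltr_pMr// ltr1n.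
have Fv0 : F (row_mx a v0) = v0 by apply/rowP => i; rewrite mxE Tv0.
(* [F] moves [v0] by at most [d / 4], and contracts by 1/2: it then maps the
   ball of radius [d / 2] around [v0] to itself. *)
have [d1 d10 Fd1] : exists2 d1 : R, 0 < d1 & forall x w, `|x - a| < d1 ->
    `|w - v0| < d1 -> `|v0 - F (row_mx x w)| <= d / 4.
  have cF : {for row_mx a v0, continuous F}.
    by apply: continuous_row => i; exact: smooth_at_continuous.
  apply: (@near_row_mx R p n a v0 (fun y => `|v0 - F y| <= d / 4)).
  have /cvgrPdist_le/(_ (d / 4)) := cF; rewrite Fv0; apply.
  by rewrite divr_gt0.
pose e := Num.min d d1; have e0 : 0 < e by rewrite lt_min d0.
pose D := [set x : 'rV[R]_p | `|x - a| < e].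
have oD : open D.
  rewrite (_ : D = ball a e); first exact: ball_open.
  by apply/seteqP; split => x; rewrite -ball_normE/= /D/= distrC.
have Dd x : D x -> `|x - a| < d by rewrite /D/= lt_min => /andP[].
have Da : D a by rewrite /D/= subrr normr0.
have uniq x w w' : D x -> `|w - v0| < d -> `|w' - v0| < d ->
    w = F (row_mx x w) -> w' = F (row_mx x w') -> w = w'.
  move=> /Dd xd wd w'd wE w'E; have := ctr x w w' xd wd w'd.
  rewrite -/(F _) -/(F _) -wE -w'E => ww'; apply/eqP.
  rewrite eq_sym -subr_eq0 -normr_le0; have := normr_ge0 (w' - w); lra.
have ex x : D x -> exists w, `|w - v0| <= d / 2 /\ w = F (row_mx x w).
  move=> Dx; have xd := Dd x Dx.
  pose B := [set w : 'rV[R]_n | `|w - v0| <= d / 2].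
  have GB : set_fun B B (fun w => F (row_mx x w)).
    move=> w wB; rewrite /B/=; have wd : `|w - v0| < d := le_lt_trans wB d2d.
    have vd : `|v0 - v0| < d by rewrite subrr normr0.
    rewrite -(subrKA (F (row_mx x v0))) (le_trans (ler_normD _ _))//.
    have : `|F (row_mx x w) - F (row_mx x v0)| <= `|w - v0| / 2 by exact: ctr.
    have : `|v0 - F (row_mx x v0)| <= d / 4.
      apply: Fd1; last by rewrite subrr normr0.
      by move: Dx; rewrite /D/= lt_min => /andP[].
    move: wB; rewrite /B/= [in X in _ -> X -> _ -> _]distrC; lra.
  have [|||w wB wE] := @banach_fixed_point R _ B (mkfun_fun GB).
  - exists (2^-1)%:nng; split; first by rewrite /= invf_lt1// ltr1n.
    move=> [w w'] [/= wB w'B]; rewrite mulrC; apply: ctr => //.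
      exact: le_lt_trans w'B d2d.
    exact: le_lt_trans wB d2d.
  - have := @closed_closed_ball_ R _ v0 (d / 2); rewrite /closed_ball_/=.
    by under eq_set do rewrite distrC.
  - by exists v0; rewrite /B/= subrr normr0 ltW.
  by exists w.
pose v x := xget v0 [set w | `|w - v0| <= d / 2 /\ w = F (row_mx x w)].
have vP x : D x -> `|v x - v0| < d /\ v x = F (row_mx x (v x)).
  move=> Dx; have [] : [set w | `|w - v0| <= d / 2 /\ w = F (row_mx x w)] (v x).
    by apply: xgetPex; exact: ex.
  by move=> vd vE; split => //; exact: le_lt_trans d2d.
have dT i x : D x -> differentiable (T i) (row_mx x (v x)).
  move=> Dx; have [+ _] := CU i 1%N; apply.
  by apply: inU; [exact: Dd|have [] := vP x Dx].
have dF x : D x -> differentiable F (row_mx x (v x)).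
  by move=> Dx; apply: differentiable_row => i; exact: dT.
have centry w x j : {for x, continuous (fun x : 'rV[R]_p => row_mx_entry x w j)}.
  rewrite /row_mx_entry; case: fintype.split => k.
    exact: (smooth_at_continuous (smooth_at_coord x k)).
  exact: (smooth_at_continuous (smooth_at_cst x (w 0 k))).
have cv (x : 'rV[R]_p) : D x -> {for x, continuous v}.
  move=> Dx; apply/(@cvgrPdist_lt _ _ _ (nbhs x)) => c c0.
  have cFx : {for x, continuous (fun x' => F (row_mx x' (v x)))}.
    have cr : {for x, continuous (fun x' => row_mx x' (v x))}.
      rewrite (_ : (fun x' => _) = fun x' => \row_j row_mx_entry x' (v x) j); last first.
        by apply/funext => x'; exact: row_mx_entryE.
      by apply: continuous_row => j; exact: centry.
    by apply: (continuous_comp cr); exact: differentiable_continuous (dF x Dx).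
  have c20 : 0 < c / 2 by rewrite divr_gt0.
  have /cvgrPdist_lt/(_ _ c20) := cFx.
  have : \forall x' \near x, D x' by exact: open_nbhs_nbhs.
  apply: filterS2 => x' Dx'; have [vd vE] := vP x Dx; have [vd' vE'] := vP x' Dx'.
  rewrite -vE; have := ctr x' (v x') (v x) (Dd _ Dx') vd' vd.
  rewrite -/(F _) -/(F _) -vE' => H1 H2.
  have := ler_normD (v x - F (row_mx x' (v x))) (F (row_mx x' (v x)) - v x').
  rewrite subrKA; lra.
have dF2 x u : D x -> `|'d F (row_mx x (v x)) (row_mx 0 u)| <= `|u| / 2.
  move=> Dx; rewrite -deriveE; last exact: dF.
  rewrite derive_row_fun; last by move=> i; exact: dT.
  apply: row_norm_le => [|i]; first by rewrite divr_ge0.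
  by rewrite mxE; apply: DT; [exact: Dd|have [] := vP x Dx].
have vF x : D x -> \forall x' \near x, v x' = F (row_mx x' (v x')).
  by move=> Dx; apply: (open_near oD Dx) => x' /vP[].
have dv x (Dx : D x) :=
  fixed_point_diff (dF x Dx) (fun u => dF2 x u Dx) (cv x Dx) (vF x Dx).
have dvi x i : D x -> differentiable (fun x => v x 0 i) x.
  move=> Dx; have [dvx _] := dv x Dx.
  by apply: (@differentiable_comp _ _ _ _ v (fun w : 'rV[R]_n => w 0 i) _ dvx);
    exact: differentiable_coord.
(* bootstrapping: if [v] is of class [C^m], so is its derivative *)
have Cv m i : C_on m D (fun x => v x 0 i).
  elim: m i => [|m IH] i.
    move=> x Dx; exact: differentiable_continuous (dvi x i Dx).
  split=> [x|h]; first exact: dvi.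
  have CTF k (u : 'rV[R]_(p + n)) :
      C_on m D (fun x => 'D_u (T k) (\row_j row_mx_entry x (v x) j)).
    apply: (@C_on_comp _ _ _ _ D U ('D_u (T k)) (fun j x => row_mx_entry x (v x) j)) => //.
    - by move=> x Dx; rewrite -row_mx_entryE; apply: inU; [exact: Dd|have [] := vP x Dx].
    - by have [_] := CU k m.+1; apply.
    - move=> j; rewrite /row_mx_entry; case: fintype.split => k' //.
      exact: C_on_coord.
  pose M x := residual_mx F v x.
  have Mu x : D x -> M x \in unitmx.
    by move=> Dx; apply: residual_unitmx => u; exact: dF2.
  have CM k j : C_on m D (fun x => M x k j).
    apply: (@eq_C_on _ _ _ _ (fun x =>
      (k == j)%:R - 'D_(row_mx 0 (delta_mx 0 k)) (T j) (\row_j row_mx_entry x (v x) j))) => //.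
      move=> x Dx; rewrite -row_mx_entryE [RHS]mxE -deriveE; last exact: dF.
      by rewrite derive_row_fun ?mxE// => i'; exact: dT.
    by apply: C_onD => //; [exact: C_on_cst|exact: C_onN].
  apply: (@eq_C_on _ _ _ _ (fun x => \sum_k
    'D_(row_mx h 0) (T k) (\row_j row_mx_entry x (v x) j) * invmx (M x) k i)) => //.
    move=> x Dx; have [dvx dvE] := dv x Dx.
    transitivity (('D_h v x) 0 i); last first.
      rewrite derive_mx; last exact: diff_derivable.
      by rewrite mxE.
    rewrite deriveE// dvE mxE; apply: eq_bigr => k _; congr (_ * _).
    rewrite -row_mx_entryE -deriveE; last exact: dF.
    by rewrite derive_row_fun ?mxE// => i'; exact: dT.
  by apply: C_on_sum => // k _; apply: C_onM => //; exact: C_on_invmx.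
exists v; split.
- have [vd vE] := vP a Da.
  by apply: (uniq a) => //; rewrite ?subrr ?normr0.
- by move=> i; exists D; [split|move=> m; exact: Cv].
- exact: vF.
- exists d => //; apply: (open_near oD Da) => x Dx w wd wE.
  by have [vd vE] := vP x Dx; exact: (uniq x).
Qed.

(** * The inverse function theorem at a unit Jacobian *)

Section LocalDiffeo.
Context {R : realType}.

Lemma lsubmx_row n m (y : 'rV[R]_(n + m)) : lsubmx y = \row_j y 0 (lshift m j).
Proof. by apply/rowP => j; rewrite !mxE. Qed.

Lemma rsubmx_row n m (y : 'rV[R]_(n + m)) : rsubmx y = \row_j y 0 (rshift n j).
Proof. by apply/rowP => j; rewrite !mxE. Qed.

Lemma smooth_at_lsubmx n m (f : 'rV[R]_n -> R) (y : 'rV[R]_(n + m)) :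
  smooth_at (lsubmx y) f -> smooth_at y (fun y : 'rV[R]_(n + m) => f (lsubmx y)).
Proof.
move=> sf; rewrite (_ : (fun _ => _) = fun y : 'rV[R]_(n + m) =>
    f (\row_j y 0 (lshift m j))); last by apply/funext => y'; rewrite lsubmx_row.
by apply: smooth_at_comp => [|j]; [rewrite -lsubmx_row|exact: smooth_at_coord].
Qed.

Lemma smooth_at_rsubmx n m (f : 'rV[R]_m -> R) (y : 'rV[R]_(n + m)) :
  smooth_at (rsubmx y) f -> smooth_at y (fun y : 'rV[R]_(n + m) => f (rsubmx y)).
Proof.
move=> sf; rewrite (_ : (fun _ => _) = fun y : 'rV[R]_(n + m) =>
    f (\row_j y 0 (rshift n j))); last by apply/funext => y'; rewrite rsubmx_row.
by apply: smooth_at_comp => [|j]; [rewrite -rsubmx_row|exact: smooth_at_coord].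
Qed.

Lemma derive_lsubmx n m (f : 'rV[R]_n -> R) (y u : 'rV[R]_(n + m)) :
  differentiable f (lsubmx y) ->
  'D_u (fun y : 'rV[R]_(n + m) => f (lsubmx y)) y = 'D_(lsubmx u) f (lsubmx y).
Proof.
move=> df; have dl := @differentiable_lsubmx R 1 n m y.
rewrite deriveE; last exact: (differentiable_comp dl df).
rewrite (diff_comp dl df)/= diff_lin; last exact: continuous_lsubmx.
by rewrite -deriveE.
Qed.

Lemma derive_rsubmx n m (f : 'rV[R]_m -> R) (y u : 'rV[R]_(n + m)) :
  differentiable f (rsubmx y) ->
  'D_u (fun y : 'rV[R]_(n + m) => f (rsubmx y)) y = 'D_(rsubmx u) f (rsubmx y).
Proof.
move=> df; have dl := @differentiable_rsubmx R 1 n m y.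
rewrite deriveE; last exact: (differentiable_comp dl df).
rewrite (diff_comp dl df)/= diff_lin; last exact: continuous_rsubmx.
by rewrite -deriveE.
Qed.

Lemma derive_coord n (y u : 'rV[R]_n) j :
  'D_u (fun y : 'rV[R]_n => y 0 j) y = u 0 j.
Proof.
have di : derivable (@idfun 'rV[R]_n) y u by exact: derivable_id.
have := derive_mx di.
by rewrite derive_id => /rowP/(_ j); rewrite mxE => ->.
Qed.

(** The inverse of [phi] at [y] is the fixed point of [w |-> y - phi w + w], a map
    whose derivative vanishes at the origin. The fixed point gives a right
    inverse, and its local uniqueness shows that it is a left inverse too. *)
Lemma diffeo_germ_unit_jacobian (phi : 'I_2 -> 'rV[R]_2 -> R) :
  (forall i, smooth_at 0 (phi i)) -> (forall i, phi i 0 = 0) ->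
  (forall i j, 'D_(delta_mx 0 j) (phi i) 0 = (i == j)%:R) ->
  diffeo_germ (fun x => \row_i phi i x).
Proof.
move=> sphi phi0 Dphi.
pose T i (y : 'rV[R]_(2 + 2)) := y 0 (lshift 2 i) - phi i (rsubmx y) + y 0 (rshift 2 i).
have E (x w : 'rV[R]_2) : \row_i T i (row_mx x w) = x - (\row_i phi i w) + w.
  by apply/rowP => i; rewrite !mxE /T row_mxEl row_mxEr row_mxKr.
have sT i : smooth_at (row_mx 0 0) (T i).
  apply: smooth_atD; last exact: smooth_at_coord.
  apply: smooth_atB; first exact: smooth_at_coord.
  by apply: smooth_at_rsubmx; rewrite row_mxKr.
have T0 i : T i (row_mx 0 0) = (0 : 'rV[R]_2) 0 i.
  by rewrite /T row_mxKr phi0 row_mx0 !mxE subrr addr0.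
have DT i j : 'D_(row_mx 0 (delta_mx 0 j)) (T i) (row_mx 0 0) = 0.
  have dphi : differentiable (phi i) (rsubmx (row_mx (0 : 'rV[R]_2) 0)).
    by rewrite row_mxKr; exact: smooth_at_differentiable.
  have d1 k : derivable (fun y : 'rV[R]_(2 + 2) => y 0 k) (row_mx 0 0)
    (row_mx 0 (delta_mx 0 j)) by exact/diff_derivable/differentiable_coord.
  have d2 : derivable (fun y : 'rV[R]_(2 + 2) => phi i (rsubmx y)) (row_mx 0 0)
      (row_mx 0 (delta_mx 0 j)).
    apply: diff_derivable; apply: smooth_at_differentiable.
    by apply: smooth_at_rsubmx; rewrite row_mxKr.
  have d3 := derivableB (d1 (lshift 2 i)) d2.
  rewrite [LHS](deriveD d3 (d1 _)) deriveB// !derive_coord derive_rsubmx//.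
  by rewrite !row_mxKr row_mxEl row_mxEr Dphi !mxE eqxx/= sub0r addNr.
have [psi [psi0 spsi psiT [r r0 uniq]]] := smooth_fixed_point sT T0 DT.
have sgphi := smooth_at_smooth_germ sphi.
have phi00 : \row_i phi i 0 = 0 by apply/rowP => i; rewrite !mxE phi0.
split; [exact: sgphi|exact: phi00|exists psi; split; [|exact: psi0| |]].
- rewrite (_ : psi = fun x => \row_j psi x 0 j); last first.
    by apply/funext => x; apply/rowP => j; rewrite mxE.
  exact: smooth_at_smooth_germ.
- have cphi : {for 0, continuous (fun x => \row_i phi i x)}.
    by apply: continuous_row => i; exact: smooth_at_continuous.
  have nr : \forall x \near (0 : 'rV[R]_2), `|x - 0| < r.
    by apply/nbhs_ballP; exists r => // x; rewrite -ball_normE/= distrC.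
  pose P y := forall w : 'rV[R]_2, `|w - 0| < r ->
    w = \row_i T i (row_mx y w) -> w = psi y.
  have nP : \forall y \near (\row_i phi i 0 : 'rV[R]_2), P y by rewrite phi00.
  have : \forall x \near (0 : 'rV[R]_2), P (\row_i phi i x) by exact: (cphi _ nP).
  apply: filterS2 nr => x xr Px; apply/esym/Px => //.
  by rewrite E subrr add0r.
- apply: filterS psiT => y; rewrite E => psiE; apply/esym/subr0_eq.
  by apply: (addIr (psi y)); rewrite add0r -psiE.
Qed.

End LocalDiffeo.

(** * Complex-valued germs *)

Section ComplexAlgebra.
Context {R : realType}.
Implicit Types (x y : R[i]).

Lemma ReD x y : complex.Re (x + y) = complex.Re x + complex.Re y.
Proof. by case: x; case: y. Qed.
Lemma ImD x y : complex.Im (x + y) = complex.Im x + complex.Im y.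
Proof. by case: x; case: y. Qed.
Lemma ReN x : complex.Re (- x) = - complex.Re x.
Proof. by case: x. Qed.
Lemma ImN x : complex.Im (- x) = - complex.Im x.
Proof. by case: x. Qed.
Lemma ReM x y : complex.Re (x * y) =
  complex.Re x * complex.Re y - complex.Im x * complex.Im y.
Proof. by case: x; case: y. Qed.
Lemma ImM x y : complex.Im (x * y) =
  complex.Re x * complex.Im y + complex.Im x * complex.Re y.
Proof. by case: x => a b; case: y => c d /=; rewrite addrC. Qed.
Lemma Re_conjc x : complex.Re (conjc x) = complex.Re x.
Proof. by case: x. Qed.
Lemma Im_conjc x : complex.Im (conjc x) = - complex.Im x.
Proof. by case: x. Qed.
Lemma conjcM x y : conjc (x * y) = conjc x * conjc y.
Proof. exact: rmorphM. Qed.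
Lemma conjcX x n : conjc (x ^+ n) = conjc x ^+ n.
Proof. exact: rmorphXn. Qed.
Lemma Re_sum (I : Type) (r : seq I) (P : pred I) (f : I -> R[i]) :
  complex.Re (\sum_(i <- r | P i) f i) = \sum_(i <- r | P i) complex.Re (f i).
Proof. by apply: (big_morph (@complex.Re R)) => //; exact: ReD. Qed.

Lemma complex_eqP x y :
  complex.Re x = complex.Re y -> complex.Im x = complex.Im y -> x = y.
Proof. by case: x => a b; case: y => c d /= -> ->. Qed.

End ComplexAlgebra.

Section ComplexCalculus.
Context {R : realType} {V : normedModType R}.
Implicit Types (a u : V) (f g : V -> R[i]).

Definition csmooth_at a f : Prop :=
  smooth_at a (fun x => complex.Re (f x)) /\
  smooth_at a (fun x => complex.Im (f x)).

Definition cderive u f a : R[i] :=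
  Complex ('D_u (fun x => complex.Re (f x)) a) ('D_u (fun x => complex.Im (f x)) a).

Lemma csmooth_at_cst a (c : R[i]) : csmooth_at a (fun=> c).
Proof. by split; exact: smooth_at_cst. Qed.

Lemma csmooth_atD a f g : csmooth_at a f -> csmooth_at a g ->
  csmooth_at a (fun x => f x + g x).
Proof.
by move=> [f1 f2] [g1 g2]; split; [under eq_fun do rewrite ReD|
  under eq_fun do rewrite ImD]; exact: smooth_atD.
Qed.

Lemma csmooth_atM a f g : csmooth_at a f -> csmooth_at a g ->
  csmooth_at a (fun x => f x * g x).
Proof.
move=> [f1 f2] [g1 g2]; split.
  by under eq_fun do rewrite ReM; apply: smooth_atB; exact: smooth_atM.
by under eq_fun do rewrite ImM; apply: smooth_atD; exact: smooth_atM.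
Qed.

Lemma csmooth_atN a f : csmooth_at a f -> csmooth_at a (fun x => - f x).
Proof.
by move=> [f1 f2]; split; [under eq_fun do rewrite ReN|
  under eq_fun do rewrite ImN]; exact: smooth_atN.
Qed.

Lemma csmooth_atB a f g : csmooth_at a f -> csmooth_at a g ->
  csmooth_at a (fun x => f x - g x).
Proof. by move=> sf sg; apply: csmooth_atD => //; exact: csmooth_atN. Qed.

Lemma csmooth_at_conj a f : csmooth_at a f -> csmooth_at a (fun x => conjc (f x)).
Proof.
move=> [f1 f2]; split; first by under eq_fun do rewrite Re_conjc.
by under eq_fun do rewrite Im_conjc; exact: smooth_atN.
Qed.

Lemma csmooth_atX a f n : csmooth_at a f -> csmooth_at a (fun x => f x ^+ n).
Proof.
move=> sf; elim: n => [|n IH]; first exact: csmooth_at_cst.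
by under eq_fun do rewrite exprS; exact: csmooth_atM.
Qed.

Lemma csmooth_derivable a u f : csmooth_at a f ->
  derivable (fun x => complex.Re (f x)) a u /\
  derivable (fun x => complex.Im (f x)) a u.
Proof. by move=> [f1 f2]; split; exact/diff_derivable/smooth_at_differentiable. Qed.

(** The rules for sums, differences and products on functions written pointwise,
    the shape left by rewriting real and imaginary parts. *)
Lemma derive_addE a u (h k : V -> R) : derivable h a u -> derivable k a u ->
  'D_u (fun x => h x + k x) a = 'D_u h a + 'D_u k a.
Proof. exact: deriveD. Qed.

Lemma derive_subE a u (h k : V -> R) : derivable h a u -> derivable k a u ->
  'D_u (fun x => h x - k x) a = 'D_u h a - 'D_u k a.
Proof. exact: deriveB. Qed.

Lemma derive_mulE a u (h k : V -> R) : derivable h a u -> derivable k a u ->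
  'D_u (fun x => h x * k x) a = h a * 'D_u k a + k a * 'D_u h a.
Proof. exact: deriveM. Qed.

Lemma derivable_mulE a u (h k : V -> R) : derivable h a u -> derivable k a u ->
  derivable (fun x => h x * k x) a u.
Proof. exact: derivableM. Qed.

Lemma cderive_cst a u (c : R[i]) : cderive u (fun=> c) a = 0.
Proof. by rewrite /cderive !derive_cst. Qed.

Lemma cderiveD a u f g : csmooth_at a f -> csmooth_at a g ->
  cderive u (fun x => f x + g x) a = cderive u f a + cderive u g a.
Proof.
move=> /csmooth_derivable-/(_ u)[f1 f2] /csmooth_derivable-/(_ u)[g1 g2].
apply: complex_eqP; rewrite /cderive ?ReD ?ImD/=.
  by under eq_fun do rewrite ReD; rewrite derive_addE.
by under eq_fun do rewrite ImD; rewrite derive_addE.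
Qed.

Lemma cderiveM a u f g : csmooth_at a f -> csmooth_at a g ->
  cderive u (fun x => f x * g x) a = f a * cderive u g a + cderive u f a * g a.
Proof.
move=> sf sg.
have [f1 f2] := csmooth_derivable u sf; have [g1 g2] := csmooth_derivable u sg.
apply: complex_eqP; rewrite /cderive ?ReD ?ImD ?ReM ?ImM/=.
  under eq_fun do rewrite ReM.
  rewrite derive_subE; [|exact: derivable_mulE..].
  by rewrite !derive_mulE//; ring.
under eq_fun do rewrite ImM.
rewrite derive_addE; [|exact: derivable_mulE..].
by rewrite !derive_mulE//; ring.
Qed.

Lemma cderiveN a u f : csmooth_at a f ->
  cderive u (fun x => - f x) a = - cderive u f a.
Proof.
move=> sf; have := cderiveM u (csmooth_at_cst a (-1)) sf.
rewrite cderive_cst mul0r addr0 mulN1r => <-.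
by congr (cderive u _ a); apply/funext => x; rewrite mulN1r.
Qed.

Lemma cderiveB a u f g : csmooth_at a f -> csmooth_at a g ->
  cderive u (fun x => f x - g x) a = cderive u f a - cderive u g a.
Proof.
by move=> sf sg; rewrite cderiveD ?cderiveN//; exact: csmooth_atN.
Qed.

Lemma cderiveX a u f n : csmooth_at a f ->
  cderive u (fun x => f x ^+ n.+1) a = n.+1%:R * f a ^+ n * cderive u f a.
Proof.
move=> sf; elim: n => [|n IH].
  by under eq_fun do rewrite expr1; rewrite expr0 mulr1 mul1r.
under eq_fun do rewrite exprS.
rewrite cderiveM//; last exact: csmooth_atX.
by rewrite IH [in RHS]mulrSr exprS; ring.
Qed.

(** The terms of the fixed point system that do not affect its value or its
    derivative at the base point; smoothness is included so that flat germs absorb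
    products by smooth ones. *)
Definition flat_at u a f : Prop :=
  [/\ csmooth_at a f, f a = 0 & cderive u f a = 0].

Lemma flat_atD a u f g : flat_at u a f -> flat_at u a g ->
  flat_at u a (fun x => f x + g x).
Proof.
move=> [sf f0 Df] [sg g0 Dg]; split; first exact: csmooth_atD.
  by rewrite f0 g0 addr0.
by rewrite cderiveD// Df Dg addr0.
Qed.

Lemma flat_atM a u f g : flat_at u a f -> csmooth_at a g ->
  flat_at u a (fun x => f x * g x).
Proof.
move=> [sf f0 Df] sg; split; first exact: csmooth_atM.
  by rewrite f0 mul0r.
by rewrite cderiveM// f0 Df !mul0r addr0.
Qed.

Lemma flat_at_sum a u (I : Type) (r : seq I) (P : pred I) (f : I -> V -> R[i]) :
  (forall i, P i -> flat_at u a (f i)) ->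
  flat_at u a (fun x => \sum_(i <- r | P i) f i x).
Proof.
move=> sf; elim: r => [|i r IH].
  under eq_fun do rewrite big_nil.
  by split; [exact: csmooth_at_cst|by []|exact: cderive_cst].
case Pi: (P i); under eq_fun do rewrite big_cons Pi; last exact: IH.
by apply: flat_atD => //; exact: sf.
Qed.

Lemma flat_at_conj a u f : flat_at u a f -> flat_at u a (fun x => conjc (f x)).
Proof.
move=> [sf f0 Df]; split; first exact: csmooth_at_conj.
  by rewrite f0 conjc0.
have [f1 f2] := csmooth_derivable u sf.
have [D1 D2] : 'D_u (fun x => complex.Re (f x)) a = 0 /\
    'D_u (fun x => complex.Im (f x)) a = 0 by case: Df.
apply: complex_eqP; rewrite /cderive/=.
  by under eq_fun do rewrite Re_conjc.
by under eq_fun do rewrite Im_conjc; rewrite [LHS]deriveN// D2 oppr0.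
Qed.

Lemma flat_atX a u f n : flat_at u a f -> (0 < n)%N -> flat_at u a (fun x => f x ^+ n).
Proof.
case: n => // n ff _; under eq_fun do rewrite exprS.
by apply: flat_atM => //; apply: csmooth_atX; have [] := ff.
Qed.

Lemma flat_at_monomial a u f m n : flat_at u a f -> (0 < m + n)%N ->
  flat_at u a (fun x => conjc (f x) ^+ m * f x ^+ n).
Proof.
move=> ff; have fc := flat_at_conj ff; case: n => [|n]; rewrite ?addn0 => mn.
  by apply: flat_atM; [exact: flat_atX|exact: csmooth_at_cst].
under eq_fun do rewrite mulrC.
apply: flat_atM; first exact: flat_atX.
by apply/csmooth_atX/csmooth_at_conj; have [] := ff.
Qed.

End ComplexCalculus.

(** * The power of the ansatz *)

(** In the conjugate of the [j]-th binomial term the exponents of [z] and of its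
    conjugate are [q * j] and [k - j]. As [2 * q] is at least
    [k - 1], the first can be below [k] for [j = 2] only; it is then [k - 1], and
    the second is [k - 2]. *)
Lemma low_exponents k q j : (k - 1 <= q * 2)%N -> (q + 2 <= k)%N ->
  (2 <= j < k.+1)%N -> ~~ (k <= q * j)%N ->
  (k - 1 <= q * j)%N /\ (q <= k - j)%N.
Proof.
move=> kq qk /andP[j2 jk]; rewrite -ltnNge => qjk.
have qj : (q * 2 <= q * j)%N by rewrite leq_mul2l j2 orbT.
split; first exact: leq_trans qj.
have [j3|j3] := ltnP 2 j; last by rewrite (_ : j = 2)%N; lia.
have : (q * 3 <= q * j)%N by rewrite leq_mul2l j3 orbT.
lia.
Qed.

Section PowerExpansion.
Context {R : realType}.
Variables (k q : nat) (c0 z w b : R[i]).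
Hypothesis c0N0 : c0 != 0.
Hypothesis k2 : (1 < k)%N.
Hypothesis kq : (k - 1 <= q * 2)%N.
Hypothesis qk : (q + 2 <= k)%N.

(** The coefficient of the [j]-th binomial term after conjugation, divided by
    [c0], so that [c0] can be factored out of the whole expansion. *)
Definition conj_coef j : R[i] :=
  conjc c0 / c0 * 'C(k, j)%:R * conjc ((1 + w) ^+ k * b ^+ j).

(** The quotients by [z ^+ k] and by [z ^+ (k - 1) * conjc z ^+ q] of the
    conjugated binomial terms of order at least two, sorted by the divisor that
    they admit. *)
Definition zk_part : R[i] := \sum_(2 <= j < k.+1 | (k <= q * j)%N)
  conjc z ^+ (k - j) * z ^+ (q * j - k) * conj_coef j.

Definition zk1_part : R[i] := \sum_(2 <= j < k.+1 | ~~ (k <= q * j)%N)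
  conjc z ^+ (k - j - q) * z ^+ (q * j - (k - 1)) * conj_coef j.

(** The terms of order 0 and 1 of the binomial expansion are left alone. Those of
    order [j] at least 2 contain [z ^+ (k - j)] only, but may be replaced by
    their conjugates under the real part, and these contain [z ^+ (q * j)]. *)
Lemma Re_power_expansion :
  complex.Re (c0 * ((1 + w) * (z + conjc z ^+ q * b)) ^+ k) =
  complex.Re (c0 * (z ^+ k * ((1 + w) ^+ k + zk_part) +
    z ^+ (k - 1) * conjc z ^+ q * (k%:R * (1 + w) ^+ k * b + zk1_part))).
Proof.
set mu := (1 + w) ^+ k.
have term j : (2 <= j < k.+1)%N ->
    complex.Re (c0 * mu * (z ^+ (k - j) * (conjc z ^+ q * b) ^+ j *+ 'C(k, j))) =
    complex.Re (c0 * (if (k <= q * j)%N then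
      z ^+ k * (conjc z ^+ (k - j) * z ^+ (q * j - k) * conj_coef j)
      else z ^+ (k - 1) * conjc z ^+ q *
        (conjc z ^+ (k - j - q) * z ^+ (q * j - (k - 1)) * conj_coef j))).
  move=> jk; rewrite -Re_conjc; congr complex.Re.
  have cK : c0 * (conjc c0 / c0) = conjc c0 by rewrite mulrCA mulfV ?mulr1.
  transitivity (conjc c0 * 'C(k, j)%:R * conjc (mu * b ^+ j) *
      (conjc z ^+ (k - j) * z ^+ (q * j))).
    rewrite -mulr_natr !conjcM !conjcX !conjcM !conjcX conjcK conjc_nat.
    by rewrite exprMn -exprM; ring.
  rewrite -cK /conj_coef; case: ifPn => kqj.
    by rewrite -[X in z ^+ X](subnKC kqj) exprD; ring.
  have [h1 h2] := low_exponents kq qk jk kqj.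
  rewrite -[X in z ^+ X](subnKC h1) -[X in conjc z ^+ X](subnKC h2) !exprD; ring.
rewrite exprMn -/mu exprDn mulrA.
rewrite -(big_mkord xpredT (fun j =>
  z ^+ (k - j) * (conjc z ^+ q * b) ^+ j *+ 'C(k, j))).
rewrite big_ltn// big_ltn ?ltnS ?(ltnW k2)//.
rewrite subn0 expr0 bin0 bin1 mulr1 mulr1n expr1 addrA mulrDr ReD.
rewrite mulr_sumr Re_sum.
rewrite (eq_big_nat _ _ term) -Re_sum -mulr_sumr -ReD; congr complex.Re.
rewrite (bigID (fun j => (k <= q * j)%N))/=.
rewrite (eq_bigr (fun j => z ^+ k *
   (conjc z ^+ (k - j) * z ^+ (q * j - k) * conj_coef j))); last by move=> j ->.
rewrite -mulr_sumr -/zk_part.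
rewrite (eq_bigr (fun j => z ^+ (k - 1) * conjc z ^+ q *
  (conjc z ^+ (k - j - q) * z ^+ (q * j - (k - 1)) * conj_coef j))); last first.
  by move=> j /negbTE->.
rewrite -mulr_sumr -/zk1_part -mulr_natr; ring.
Qed.

End PowerExpansion.

(** * Absorbing a perturbation by a change of coordinates *)

Section Absorption.
Context {R : realType}.

Definition zc (x : 'rV[R]_2) : R[i] := Complex (x 0 0) (x 0 1).

Let i4 j (j4 : (j < 4)%N) : 'I_4 := Ordinal j4.
Definition fst_c (u : 'rV[R]_4) : R[i] := Complex (u 0 (@i4 0 isT)) (u 0 (@i4 1 isT)).
Definition snd_c (u : 'rV[R]_4) : R[i] := Complex (u 0 (@i4 2 isT)) (u 0 (@i4 3 isT)).
(** The fixed point theorem is about real coordinates; pairs of complex numbers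
    are therefore stored as four reals. *)
Definition pair_c (x y : R[i]) (i : 'I_4) : R :=
  nth 0 [:: complex.Re x; complex.Im x; complex.Re y; complex.Im y] i.

Lemma fst_pair_c x y : fst_c (\row_i pair_c x y i) = x.
Proof. by case: x => a b; rewrite /fst_c !mxE. Qed.

Lemma snd_pair_c x y : snd_c (\row_i pair_c x y i) = y.
Proof. by case: y => a b; rewrite /snd_c !mxE. Qed.

Lemma csmooth_at_zc (a : 'rV[R]_2) : csmooth_at a zc.
Proof. by split; exact: smooth_at_coord. Qed.

Lemma zc0 : zc 0 = 0.
Proof. by rewrite /zc !mxE. Qed.

Lemma csmooth_at_fst_c (a : 'rV[R]_4) : csmooth_at a fst_c.
Proof. by split; exact: smooth_at_coord. Qed.

Lemma csmooth_at_snd_c (a : 'rV[R]_4) : csmooth_at a snd_c.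
Proof. by split; exact: smooth_at_coord. Qed.

Lemma csmooth_at_lsubmx n m (f : 'rV[R]_n -> R[i]) (y : 'rV[R]_(n + m)) :
  csmooth_at (lsubmx y) f -> csmooth_at y (fun y : 'rV[R]_(n + m) => f (lsubmx y)).
Proof.
move=> [f1 f2]; split.
  exact: (smooth_at_lsubmx (f := fun x => complex.Re (f x))).
exact: (smooth_at_lsubmx (f := fun x => complex.Im (f x))).
Qed.

Lemma csmooth_at_rsubmx n m (f : 'rV[R]_m -> R[i]) (y : 'rV[R]_(n + m)) :
  csmooth_at (rsubmx y) f -> csmooth_at y (fun y : 'rV[R]_(n + m) => f (rsubmx y)).
Proof.
move=> [f1 f2]; split.
  exact: (smooth_at_rsubmx (f := fun x => complex.Re (f x))).
exact: (smooth_at_rsubmx (f := fun x => complex.Im (f x))).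
Qed.

Lemma cderive_lsubmx n m (f : 'rV[R]_n -> R[i]) (y : 'rV[R]_(n + m)) (u : 'rV[R]_m) :
  csmooth_at (lsubmx y) f ->
  cderive (row_mx 0 u) (fun y : 'rV[R]_(n + m) => f (lsubmx y)) y = 0.
Proof.
move=> [f1 f2]; apply: complex_eqP; rewrite /cderive/=.
  rewrite (derive_lsubmx (f := fun x => complex.Re (f x))) ?row_mxKl ?derive0//.
  exact: smooth_at_differentiable.
rewrite (derive_lsubmx (f := fun x => complex.Im (f x))) ?row_mxKl ?derive0//.
exact: smooth_at_differentiable.
Qed.

Variables (k q : nat) (c0 : R[i]) (W c : 'rV[R]_2 -> R[i]).
Hypothesis c0N0 : c0 != 0.
Hypothesis k2 : (1 < k)%N.
Hypothesis q2 : (1 < q)%N.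
Hypothesis kq : (k - 1 <= q * 2)%N.
Hypothesis qk : (q + 2 < k)%N.
Hypothesis (sW : csmooth_at 0 W) (sc : csmooth_at 0 c) (W0 : W 0 = 0).

(** The system to be solved is
    [(1 + w) ^+ k + E = 1 + W] and [k * (1 + w) ^+ k * b + E2 = c], which makes the
    expansion of [Re_power_expansion] the perturbed germ. At the origin its
    solution is [w = 0], [b = b0]. Both equations are put in fixed point form:
    in the first, [w] is isolated by a Newton step with the derivative [k]
    at [w = 0]; in the second, the power of [1 + w] is replaced by [1 + W - E],
    its value by the first, and the equation is divided by [k]. *)
Let b0 := c 0 / k%:R.
Let v0 : 'rV[R]_4 := \row_i pair_c 0 b0 i.
Let y0 : 'rV[R]_(2 + 4) := row_mx 0 v0.
Let z (y : 'rV[R]_(2 + 4)) := zc (lsubmx y).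
Let w (y : 'rV[R]_(2 + 4)) := fst_c (rsubmx y).
Let b (y : 'rV[R]_(2 + 4)) := snd_c (rsubmx y).
Let E y := zk_part k q c0 (z y) (w y) (b y).
Let E2 y := zk1_part k q c0 (z y) (w y) (b y).
Let Tw y := w y - ((1 + w y) ^+ k - 1 - W (lsubmx y) + E y) * k%:R^-1.
Let Tb y := (c (lsubmx y) - E2 y) * k%:R^-1 - (W (lsubmx y) - E y) * b y.

Let kN0 : (k%:R : R[i]) != 0.
Proof. by rewrite pnatr_eq0; case: k k2. Qed.

Let w0 : w y0 = 0. Proof. by rewrite /w row_mxKr fst_pair_c. Qed.
Let z0 : z y0 = 0. Proof. by rewrite /z row_mxKl zc0. Qed.
Let sw : csmooth_at y0 w.
Proof. by apply: csmooth_at_rsubmx; exact: csmooth_at_fst_c. Qed.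
Let sb : csmooth_at y0 b.
Proof. by apply: csmooth_at_rsubmx; exact: csmooth_at_snd_c. Qed.
Let sWl : csmooth_at y0 (fun y => W (lsubmx y)).
Proof. by apply: csmooth_at_lsubmx; rewrite row_mxKl. Qed.
Let scl : csmooth_at y0 (fun y => c (lsubmx y)).
Proof. by apply: csmooth_at_lsubmx; rewrite row_mxKl. Qed.

Let s1w : csmooth_at y0 (fun y => 1 + w y).
Proof. by apply: csmooth_atD => //; exact: csmooth_at_cst. Qed.

Let s_coef j : csmooth_at y0 (fun y => conj_coef k c0 (w y) (b y) j).
Proof.
apply: csmooth_atM; first exact: csmooth_at_cst.
by apply/csmooth_at_conj/csmooth_atM; exact: csmooth_atX.
Qed.

Section Direction.
Variable u : 'rV[R]_4.
Let d : 'rV[R]_(2 + 4) := row_mx 0 u.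

Let z_flat : flat_at d y0 z.
Proof.
split => //; first by apply: csmooth_at_lsubmx; exact: csmooth_at_zc.
by apply: cderive_lsubmx; exact: csmooth_at_zc.
Qed.

(** Every term has a positive power of [z] or of its conjugate left, because [q]
    exceeds 1. *)
Lemma zk_part_flat : flat_at d y0 E.
Proof.
rewrite /E /zk_part; under eq_fun do rewrite big_nat_cond.
apply: flat_at_sum => j /andP[/andP[j2 jk] kqj].
apply: flat_atM; last exact: s_coef.
apply: flat_at_monomial => //.
have : (2 * j <= q * j)%N by rewrite leq_mul2r q2 orbT.
lia.
Qed.

(** Only [j = 2] occurs here, and [conjc z ^+ (k - 2 - q)] remains, with a
    positive exponent. *)
Lemma zk1_part_flat : flat_at d y0 E2.
Proof.
rewrite /E2 /zk1_part; under eq_fun do rewrite big_nat_cond.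
apply: flat_at_sum => j /andP[j2k kqj].
apply: flat_atM; last exact: s_coef.
apply: flat_at_monomial => //.
have [h1 h2] := low_exponents kq (ltnW qk) j2k kqj.
have [j3|j3] := ltnP 2 j; last by have : (j = 2)%N; lia.
have : (q * 3 <= q * j)%N by rewrite leq_mul2l j3 orbT.
lia.
Qed.

(** The derivative of the Newton step vanishes at its base point. *)
Lemma Tw_flat : [/\ csmooth_at y0 Tw, Tw y0 = 0 & cderive d Tw y0 = 0].
Proof.
have [sE E0 DE] := zk_part_flat.
have s1 : csmooth_at y0 (fun y => (1 + w y) ^+ k - 1 - W (lsubmx y) + E y).
  apply: csmooth_atD => //; apply: csmooth_atB => //; apply: csmooth_atB.
    exact: csmooth_atX.
  exact: csmooth_at_cst.
have s2 : csmooth_at y0 (fun=> (k%:R : R[i])^-1) by exact: csmooth_at_cst.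
split.
- by apply: csmooth_atB => //; exact: csmooth_atM.
- by rewrite /Tw w0 E0 row_mxKl W0 !addr0 expr1n !subrr mul0r subr0.
- rewrite cderiveB//; last exact: csmooth_atM.
  rewrite cderiveM// cderive_cst mulr0 add0r.
  have sX := csmooth_atX k s1w; have s11 : csmooth_at y0 (fun=> (1 : R[i])).
    exact: csmooth_at_cst.
  have sX1 := csmooth_atB sX s11; have sX2 := csmooth_atB sX1 sWl.
  rewrite (cderiveD d sX2 sE) DE addr0 (cderiveB d sX1 sWl) (cderiveB d sX s11).
  rewrite cderive_cst cderive_lsubmx ?row_mxKl// !subr0.
  rewrite -[X in cderive d (fun y => _ ^+ X)](ltn_predK k2) cderiveX//.
  rewrite (ltn_predK k2) w0 addr0 expr1n mulr1 cderiveD//.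
  by rewrite cderive_cst add0r mulrAC mulfV// mul1r subrr.
Qed.

Lemma Tb_flat : [/\ csmooth_at y0 Tb, Tb y0 = b0 & cderive d Tb y0 = 0].
Proof.
have [sE E0 DE] := zk_part_flat; have [sE2 E20 DE2] := zk1_part_flat.
have s1 := csmooth_atB scl sE2.
have s2 : csmooth_at y0 (fun=> (k%:R : R[i])^-1) by exact: csmooth_at_cst.
have s3 := csmooth_atB sWl sE.
have [s4 f0 Df] : flat_at d y0 (fun y => (W (lsubmx y) - E y) * b y).
  apply: flat_atM => //; split => //; first by rewrite row_mxKl W0 E0 subr0.
  by rewrite cderiveB// cderive_lsubmx ?row_mxKl// DE subr0.
split.
- by apply: csmooth_atB => //; exact: csmooth_atM.
- by rewrite /Tb f0 subr0 E20 subr0 row_mxKl.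
- rewrite (cderiveB d (csmooth_atM s1 s2) s4) Df subr0 (cderiveM d s1 s2).
  rewrite cderive_cst mulr0 add0r cderiveB// DE2 cderive_lsubmx ?row_mxKl//.
  by rewrite subr0 mul0r.
Qed.

End Direction.

(** The change of coordinates is [(1 + w) * (z + conjc z ^+ q * b)] for the
    solution [(w, b)] of the system above; since [q] is at least 2 and [w]
    vanishes at the origin, it is the identity to first order. *)
Theorem absorb_perturbation : exists2 phi : 'rV[R]_2 -> 'rV[R]_2, diffeo_germ phi &
  \forall x \near (0 : 'rV[R]_2), complex.Re (c0 * zc (phi x) ^+ k) =
    complex.Re (c0 * (zc x ^+ k * (1 + W x) +
      zc x ^+ (k - 1) * conjc (zc x) ^+ q * c x)).
Proof.
have [sTw Tw0 _] := Tw_flat 0; have [sTb Tb0 _] := Tb_flat 0.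
pose T i y := pair_c (Tw y) (Tb y) i.
have sT i : smooth_at y0 (T i).
  case: sTw => ? ?; case: sTb => ? ?.
  by case: i => -[|[|[|[|//]]]] /= ?.
have T0 i : T i y0 = v0 0 i by rewrite /T Tw0 Tb0 mxE.
have DT i j : 'D_(row_mx 0 (delta_mx 0 j)) (T i) y0 = 0.
  have [_ _] := Tw_flat (delta_mx 0 j); have [_ _] := Tb_flat (delta_mx 0 j).
  by rewrite /cderive; case: i => -[|[|[|[|//]]]] /= ? [? ?] [? ?].
have [v [va sv vT _]] := smooth_fixed_point sT T0 DT.
pose wx x := fst_c (v x); pose bx x := snd_c (v x).
have swx : csmooth_at 0 wx by split; exact: sv.
have sbx : csmooth_at 0 bx by split; exact: sv.
have wx0 : wx 0 = 0 by rewrite /wx va fst_pair_c.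
pose psi x := (1 + wx x) * (zc x + conjc (zc x) ^+ q * bx x).
have sz := csmooth_at_zc (0 : 'rV[R]_2).
have s1wx : csmooth_at 0 (fun x => 1 + wx x).
  by apply: csmooth_atD => //; exact: csmooth_at_cst.
have szq := csmooth_atX q (csmooth_at_conj sz).
have szqb := csmooth_atM szq sbx.
have s2 := csmooth_atD sz szqb.
have spsi : csmooth_at 0 psi := csmooth_atM s1wx s2.
have psi0 : psi 0 = 0.
  by rewrite /psi zc0 conjc0 expr0n (gtn_eqF (ltnW q2)) mul0r addr0 mulr0.
have Dpsi u : cderive u psi 0 = cderive u zc 0.
  rewrite (cderiveM u s1wx s2) zc0 conjc0 expr0n (gtn_eqF (ltnW q2)) mul0r.
  rewrite addr0 mulr0 addr0 wx0 addr0 mul1r (cderiveD u sz szqb).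
  rewrite (cderiveM u szq sbx) zc0 conjc0 expr0n (gtn_eqF (ltnW q2)) mul0r add0r.
  rewrite -[X in fun x => _ ^+ X](ltn_predK q2) cderiveX; last exact: csmooth_at_conj.
  have q1 : (q.-1 == 0)%N = false by apply/negbTE; lia.
  by rewrite zc0 conjc0 expr0n q1 mulr0 !mul0r addr0.
pose phi (i : 'I_2) x : R := nth 0 [:: complex.Re (psi x); complex.Im (psi x)] i.
have zphi x : zc (\row_i phi i x) = psi x.
  by rewrite /zc !mxE /phi/=; case: (psi x).
exists (fun x => \row_i phi i x).
  apply: diffeo_germ_unit_jacobian.
  - by case: spsi => ? ? [[|[|//]]] ?.
  - by case=> -[|[|//]] ? /=; rewrite /phi/= psi0.
  - move=> i j; have := Dpsi (delta_mx 0 j); rewrite /cderive.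
    rewrite !derive_coord !mxE/= => -[D1 D2].
    case: i => -[|[|//]] i2; [rewrite [LHS]D1|rewrite [LHS]D2]; congr (_%:R);
    by rewrite eq_sym.
apply: filterS vT => x vx; rewrite zphi.
have wE : wx x = Tw (row_mx x (v x)) by rewrite /wx {1}vx fst_pair_c.
have bE : bx x = Tb (row_mx x (v x)) by rewrite /bx {1}vx snd_pair_c.
rewrite /Tw /Tb /E /E2 /z /w /b row_mxKl row_mxKr -/(wx x) -/(bx x) in wE bE.
rewrite /psi Re_power_expansion//; last by lia.
set Ex := zk_part _ _ _ _ _ _ in wE bE *; set E2x := zk1_part _ _ _ _ _ _ in wE bE *.
have muE : (1 + wx x) ^+ k + Ex = 1 + W x.
  have : ((1 + wx x) ^+ k - 1 - W x + Ex) * k%:R^-1 = 0.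
    have : wx x - wx x = wx x - (wx x - ((1 + wx x) ^+ k - 1 - W x + Ex) * k%:R^-1).
      by rewrite -wE.
    by rewrite subrr subKr.
  move=> /eqP; rewrite mulf_eq0 invr_eq0 (negbTE kN0) orbF => /eqP H.
  by apply/subr0_eq; rewrite -[RHS]H; ring.
have cE : k%:R * (1 + wx x) ^+ k * bx x + E2x = c x.
  have -> : (1 + wx x) ^+ k = 1 + W x - Ex by rewrite -muE addrK.
  have : k%:R * bx x = c x - E2x - k%:R * ((W x - Ex) * bx x).
    by rewrite {1}bE mulrBr mulrCA mulfV// mulr1.
  move=> H; apply/subr0_eq.
  rewrite (_ : _ - _ = k%:R * bx x - (c x - E2x - k%:R * ((W x - Ex) * bx x))).
    by rewrite H subrr.
  by ring.
by rewrite muE cE.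
Qed.

End Absorption.

(** * Polynomials in z and its conjugate *)

Section ComplexCoordinates.
Context {R : realType}.
Local Notation C := R[i].
Implicit Types (p : mpoly 2 R) (q : mpoly 2 C).

Let I0 : 'I_2 := 0.
Let I1 : 'I_2 := 1.
Let X0 : mpoly 2 C := mpolyX C (mnm1 I0).
Let X1 : mpoly 2 C := mpolyX C (mnm1 I1).
Let im : C := Complex 0 1.

Let lin (a b : C) : mpoly 2 C := a *: X0 + b *: X1.

(** The coordinates [x = (z + zbar) / 2] and [y = (z - zbar) / (2 i)]; from here
    on, the variables of a complex polynomial are [z] and [zbar], in this
    order. *)
Definition coord_form (j : 'I_2) : mpoly 2 C :=
  if j == I0 then lin 2^-1 2^-1 else lin (2 * im)^-1 (- (2 * im)^-1).

Let of_real : R -> mpoly 2 C := (@mpolyC 2 C) \o (real_complex R).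

Definition to_zzbar p : mpoly 2 C := mmap of_real coord_form p.

Lemma to_zzbar0 : to_zzbar 0 = 0.
Proof. exact: raddf0. Qed.

Lemma to_zzbarD p p' : to_zzbar (p + p') = to_zzbar p + to_zzbar p'.
Proof. exact: raddfD. Qed.

Lemma to_zzbarZX c (m : multinom 2) : to_zzbar (c *: mpolyX R m) =
  (real_complex R c) *: (coord_form I0 ^+ m I0 * coord_form I1 ^+ m I1).
Proof.
rewrite /to_zzbar mmapZ mmapX /mmap1 big_ord_recl big_ord1 /of_real/=.
rewrite -mul_mpolyC; congr (_ * (_ ^+ m _ * _ ^+ m _)); exact: val_inj.
Qed.

Lemma ord2E (P : 'I_2 -> Prop) : P I0 -> P I1 -> forall i, P i.
Proof.
move=> P0 P1 [[|[|//]] i2]; first by rewrite (_ : Ordinal i2 = I0)//; exact: val_inj.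
by rewrite (_ : Ordinal i2 = I1)//; exact: val_inj.
Qed.

Definition zzbar (x : 'rV[R]_2) (i : 'I_2) : C := if i == I0 then zc x else conjc (zc x).

Lemma imN0 : im != 0.
Proof. by apply/eqP => -[] /eqP; rewrite oner_eq0. Qed.

Lemma twoN0 : (2 : C) != 0.
Proof. by rewrite pnatr_eq0. Qed.

Lemma meval_coord_form x j : meval (zzbar x) (coord_form j) = (real_complex R (x 0 j)).
Proof.
have XE k : meval (zzbar x) (mpolyX C (mnm1 k)) = zzbar x k by exact: mevalXU.
have z0 : zzbar x I0 = zc x by [].
have z1 : zzbar x I1 = conjc (zc x) by [].
have linE a b : meval (zzbar x) (lin a b) = a * zc x + b * conjc (zc x).
  by rewrite /lin mevalD !mevalZ !XE z0 z1.
elim/ord2E: j; rewrite /coord_form/= linE ?mulNr -?mulrDr -?mulrBr.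
  by rewrite addcJ/= mulKf//; exact: twoN0.
rewrite subcJ/= -/im mulrAC mulKf//; apply: mulf_neq0; [exact: twoN0|exact: imN0].
Qed.

Lemma meval_to_zzbar p x : meval (zzbar x) (to_zzbar p) = real_complex R (poly_fun p x).
Proof.
have rcD (a b : R) : real_complex R (a + b) = real_complex R a + real_complex R b.
  exact: rmorphD.
have rcM (a b : R) : real_complex R (a * b) = real_complex R a * real_complex R b.
  exact: rmorphM.
have rcX (a : R) n : real_complex R (a ^+ n) = real_complex R a ^+ n.
  exact: rmorphXn.
elim/mpolyind: p => [|c m p _ _ IH].
  by rewrite to_zzbar0 /poly_fun !meval0.
have -> : poly_fun (c *: mpolyX R m + p) x =
    c * (x 0 I0 ^+ m I0 * x 0 I1 ^+ m I1) + poly_fun p x.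
  rewrite /poly_fun mevalD mevalZ mevalX big_ord_recl big_ord1.
  by congr (_ * (x 0 _ ^+ m _ * x 0 _ ^+ m _) + _); exact: val_inj.
rewrite rcD rcM rcM !rcX -IH -!meval_coord_form to_zzbarD to_zzbarZX.
rewrite mevalD mevalZ mevalM.
by congr (_ * (_ * _) + _); rewrite rmorphXn.
Qed.

(** The derivations of the polynomials in [z] and [zbar] that correspond to
    [d/dx] and [d/dy] under [to_zzbar]. *)
Definition dx q : mpoly 2 C := mderiv I0 q + mderiv I1 q.
Definition dy q : mpoly 2 C := im *: (mderiv I0 q - mderiv I1 q).

Lemma dxD q q' : dx (q + q') = dx q + dx q'.
Proof. by rewrite /dx !mderivD addrACA. Qed.
Lemma dyD q q' : dy (q + q') = dy q + dy q'.
Proof. by rewrite /dy !mderivD opprD addrACA scalerDr. Qed.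
Lemma dxZ c q : dx (c *: q) = c *: dx q.
Proof. by rewrite /dx !mderivZ scalerDr. Qed.
Lemma dyZ c q : dy (c *: q) = c *: dy q.
Proof. by rewrite /dy !mderivZ -scalerBr !scalerA mulrC. Qed.
Lemma dxM q q' : dx (q * q') = dx q * q' + q * dx q'.
Proof. by rewrite /dx !mderivM; ring. Qed.
Lemma dyM q q' : dy (q * q') = dy q * q' + q * dy q'.
Proof.
by rewrite /dy !mderivM -scalerAl -scalerAr -scalerDr; congr (_ *: _); ring.
Qed.

Lemma derivationX (D : mpoly 2 C -> mpoly 2 C) q c n :
  (forall q1 q2, D (q1 * q2) = D q1 * q2 + q1 * D q2) -> D q = c ->
  D (q ^+ n) = n%:R * c * q ^+ n.-1.
Proof.
move=> DM Dq; elim: n => [|n IH].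
  rewrite !mul0r expr0; have := DM 1 1; rewrite !mulr1 mul1r => /eqP.
  by rewrite -subr_eq0 opprD addNKr oppr_eq0 => /eqP.
rewrite exprS DM Dq IH /=; case: n {IH} => [|n]; first by rewrite !mul0r mulr0 addr0 mul1r.
by rewrite /= [in RHS]mulrSr exprS; ring.
Qed.

Lemma mderiv_var (i j : 'I_2) : mderiv i (mpolyX C (mnm1 j)) = (j == i)%:R.
Proof.
rewrite mderivX mnm1E; case: eqP => [->|_]; last by rewrite scale0r.
rewrite scale1r (_ : mnm_sub _ _ = mnm0) ?mpolyX0//.
by apply/mnmP => k; rewrite mnmBE subnn mnm0E.
Qed.

Lemma dx_lin a b : dx (lin a b) = (a + b) *: 1.
Proof.
rewrite /lin dxD !dxZ /dx !mderiv_var/= addr0 add0r.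
by rewrite -scalerDl.
Qed.

Lemma dy_lin a b : dy (lin a b) = (im * (a - b)) *: 1.
Proof.
rewrite /lin dyD !dyZ /dy !mderiv_var/= subr0 sub0r scalerN.
by rewrite [a *: _]scalerA [b *: _]scalerN scalerA -scalerBl; congr (_ *: _); ring.
Qed.

Lemma d_coord_form : [/\ dx (coord_form I0) = 1, dx (coord_form I1) = 0,
  dy (coord_form I0) = 0 & dy (coord_form I1) = 1].
Proof.
have t0 := twoN0; have i0 := imN0.
have h : (2^-1 + 2^-1 : C) = 1 by field.
have h1 : im * ((2 * im)^-1 + (2 * im)^-1) = 1 by field.
split.
- by rewrite [LHS]dx_lin h scale1r.
- by rewrite [LHS]dx_lin subrr scale0r.
- by rewrite [LHS]dy_lin subrr mulr0 scale0r.
- by rewrite [LHS]dy_lin opprK h1 scale1r.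
Qed.

Lemma d_monomial a b :
  dx (coord_form I0 ^+ a * coord_form I1 ^+ b) =
    a%:R *: (coord_form I0 ^+ a.-1 * coord_form I1 ^+ b) /\
  dy (coord_form I0 ^+ a * coord_form I1 ^+ b) =
    b%:R *: (coord_form I0 ^+ a * coord_form I1 ^+ b.-1).
Proof.
have [x0 x1 y0 y1] := d_coord_form.
have X0E := derivationX a dxM x0; have X1E := derivationX b dxM x1.
have Y0E := derivationX a dyM y0; have Y1E := derivationX b dyM y1.
rewrite !scaler_nat; split.
  rewrite [LHS]dxM X0E X1E mulr0 mul0r mulr0 addr0 mulr1.
  by rewrite -mulrA mulr_natl.
rewrite [LHS]dyM Y0E Y1E mulr0 !mul0r add0r mulr1.
by rewrite mulrCA mulr_natl.
Qed.

Lemma to_zzbar_mderiv p : to_zzbar (mderiv I0 p) = dx (to_zzbar p) /\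
  to_zzbar (mderiv I1 p) = dy (to_zzbar p).
Proof.
have rcM (a b : R) : real_complex R (a * b) = real_complex R a * real_complex R b.
  exact: rmorphM.
have rcn n : real_complex R n%:R = n%:R by exact: rmorph_nat.
elim/mpolyind: p => [|c m p _ _ [IHx IHy]].
  by rewrite !mderiv0 to_zzbar0 /dx /dy !mderiv0 subrr addr0 scaler0.
have [Ex Ey] := d_monomial (m I0) (m I1).
rewrite !mderivD !mderivZ !mderivX !scalerA !to_zzbarD !to_zzbarZX IHx IHy.
rewrite dxD dyD dxZ dyZ Ex Ey !scalerA !mnmBE !mnm1E/= !rcM !rcn.
by rewrite !subn0 !subn1.
Qed.

(** The sum of the squares of [dx] and [dy] is [(D + D') ^+ 2 - (D - D') ^+ 2],
    where [D] and [D'] are the derivations by [z] and [zbar]. *)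
Lemma to_zzbar_laplacian p :
  to_zzbar (laplacian p) = 4 *: mderiv I0 (mderiv I1 (to_zzbar p)).
Proof.
have i2 : im * im = -1 by apply: complex_eqP; rewrite /=; ring.
rewrite /laplacian big_ord_recl big_ord1.
have -> : lift ord0 ord0 = I1 :> 'I_2 by exact: val_inj.
have -> : ord0 = I0 :> 'I_2 by exact: val_inj.
rewrite to_zzbarD; have [-> _] := to_zzbar_mderiv (mderiv I0 p).
have [_ ->] := to_zzbar_mderiv (mderiv I1 p).
have [-> ->] := to_zzbar_mderiv p; set q := to_zzbar p.
rewrite {2}/dy dyZ /dy scalerA i2 scaleN1r /dx !mderivD !mderivN.
rewrite [mderiv I1 (mderiv I0 q)]mderiv_comm scaler_nat.
move: (mderiv I0 (mderiv I0 q)) (mderiv I0 (mderiv I1 q)) (mderiv I1 (mderiv I1 q)).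
by move=> q00 q01 q11; ring.
Qed.

(** In characteristic 0, [s] derivations by each of [z] and [zbar] kill only the
    monomials in which one of the exponents is below [s]. *)
Lemma mcoeff_iter_ddbar s q : iter s (fun q => mderiv I0 (mderiv I1 q)) q = 0 ->
  forall m : multinom 2, (s <= m I0)%N -> (s <= m I1)%N -> mcoeff m q = 0.
Proof.
elim: s q => [|s IH] q; first by move=> /= -> m _ _; rewrite mcoeff0.
rewrite iterSr => /IH H m m0 m1.
pose m' := mnm_add (mnm_muln (mnm1 I0) (m I0).-1) (mnm_muln (mnm1 I1) (m I1).-1).
have mE : m = mnm_add m' (mnm_add (mnm1 I0) (mnm1 I1)).
  by apply/mnmP; elim/ord2E; rewrite !mnmDE !mulmnE !mnm1E/=; lia.
have /H : (s <= m' I0)%N by rewrite !mnmDE !mulmnE !mnm1E/=; lia.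
have m'1 : (s <= m' I1)%N by rewrite !mnmDE !mulmnE !mnm1E/=; lia.
move=> /(_ m'1); rewrite !mcoeff_mderiv -addmA -mE => /eqP.
by rewrite !mulrn_eq0/= => /eqP.
Qed.

(** The hypothesis on the perturbation enters here: in degree [d], only
    monomials having [z] or [zbar] to a power above [d - s] survive. *)
Lemma laplacian_kernel s p : iter s (@laplacian R) p = 0 ->
  forall m : multinom 2, (s <= m I0)%N -> (s <= m I1)%N -> mcoeff m (to_zzbar p) = 0.
Proof.
move=> Lp; apply: mcoeff_iter_ddbar.
have LE n q : iter n (fun q => mderiv I0 (mderiv I1 q)) q =
    (4 ^- n) *: iter n (fun q => 4 *: mderiv I0 (mderiv I1 q)) q.
  elim: n => [|n IH]; first by rewrite expr0 invr1 scale1r.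
  rewrite !iterS IH !mderivZ scalerA exprS invfM mulrAC.
  by rewrite mulVf ?mul1r// pnatr_eq0.
rewrite LE; suff -> : iter s (fun q => 4 *: mderiv I0 (mderiv I1 q)) (to_zzbar p) =
    to_zzbar (iter s (@laplacian R) p) by rewrite Lp to_zzbar0 scaler0.
elim: s {Lp} => [|s IH]; first by [].
by rewrite !iterS IH to_zzbar_laplacian.
Qed.

Lemma coord_form_homog j : coord_form j \is ishomog1 1 (@mdeg 2).
Proof.
have XH k : mpolyX C (mnm1 k) \is ishomog1 1 (@mdeg 2) by rewrite dhomogX; apply/eqP; exact: mdeg1.
by elim/ord2E: j; apply: rpredD; apply: rpredZ; exact: XH.
Qed.

Lemma to_zzbar_homog d p : homogeneous_poly d p ->
  to_zzbar p \is ishomog1 d (@mdeg 2).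
Proof.
move=> /dhomogP pd; rewrite (mpolyE p) (big_morph to_zzbar to_zzbarD to_zzbar0) big_seq.
apply: rpred_sum => m /pd md; rewrite to_zzbarZX; apply: rpredZ.
have -> : d = (1 * m I0 + 1 * m I1)%N.
  have {}md : mdeg m = d := md.
  rewrite -md mdegE big_ord_recl big_ord1 !mul1n.
  by congr (m _ + m _)%N; exact: val_inj.
by apply: dhomogM; apply: dhomogMn; exact: coord_form_homog.
Qed.

End ComplexCoordinates.

(** * Perturbations that can be absorbed *)

(** The filter lemmas at neighbourhoods of a point, with a fixed filter instance:
    unification against complex expressions is then immediate. *)
Lemma near_all (R : realType) (V : normedModType R) (a : V) (P : V -> Prop) :
  (forall x, P x) -> \forall x \near a, P x.
Proof. by move=> Px; exact: nearW. Qed.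

Lemma near_imp (R : realType) (V : normedModType R) (a : V) (P Q : V -> Prop) :
  (forall x, P x -> Q x) -> (\forall x \near a, P x) -> \forall x \near a, Q x.
Proof. by move=> PQ nP; apply: filterS nP. Qed.

Lemma near_imp2 (R : realType) (V : normedModType R) (a : V) (P Q S : V -> Prop) :
  (forall x, P x -> Q x -> S x) -> (\forall x \near a, P x) ->
  (\forall x \near a, Q x) -> \forall x \near a, S x.
Proof. by move=> PQS nP nQ; apply: filterS2 nP nQ. Qed.

Section Absorbable.
Context {R : realType}.
Variables (k q : nat) (c0 : R[i]).
Hypothesis c0N0 : c0 != 0.
Implicit Types (f : 'rV[R]_2 -> R) (g : 'rV[R]_2 -> R[i]).

(** The perturbations to which [absorb_perturbation] applies, factored by [c0]. *)
Definition absorbable f : Prop := exists W c : 'rV[R]_2 -> R[i],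
  [/\ csmooth_at 0 W, W 0 = 0, csmooth_at 0 c &
      \forall x \near (0 : 'rV[R]_2), f x = complex.Re (c0 *
        (zc x ^+ k * W x + zc x ^+ (k - 1) * conjc (zc x) ^+ q * c x))].

Lemma absorbable0 : absorbable (fun=> 0).
Proof.
exists (fun=> 0), (fun=> 0); split => //; try exact: csmooth_at_cst.
by apply: near_all => x; rewrite !mulr0 addr0 mulr0.
Qed.

Lemma absorbableD f f' : absorbable f -> absorbable f' ->
  absorbable (fun x => f x + f' x).
Proof.
move=> [W [c [sW W0 sc fE]]] [W' [c' [sW' W0' sc' fE']]].
exists (fun x => W x + W' x), (fun x => c x + c' x); split.
- exact: csmooth_atD.
- by rewrite W0 W0' addr0.
- exact: csmooth_atD.
- by apply: near_imp2 fE fE' => x -> ->; rewrite -ReD; congr complex.Re; ring.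
Qed.

Lemma absorbable_sum (I : eqType) (r : seq I) (f : I -> 'rV[R]_2 -> R) :
  (forall i, i \in r -> absorbable (f i)) ->
  absorbable (fun x => \sum_(i <- r) f i x).
Proof.
elim: r => [|i r IH] fr.
  by under eq_fun do rewrite big_nil; exact: absorbable0.
under eq_fun do rewrite big_cons.
apply: absorbableD; first by apply: fr; rewrite mem_head.
by apply: IH => j jr; apply: fr; rewrite in_cons jr orbT.
Qed.

Lemma eq_absorbable f f' : (\forall x \near (0 : 'rV[R]_2), f x = f' x) ->
  absorbable f -> absorbable f'.
Proof.
move=> ff' [W [c [sW W0 sc fE]]]; exists W, c; split => //.
by apply: near_imp2 ff' fE => x ->.
Qed.

(** Under the real part, a monomial may be conjugated, so the two exponents play
    symmetric roles. A total degree above [k] ensures that [W] vanishes at the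
    origin. *)
Lemma absorbable_monomial g i j : csmooth_at 0 g -> (k < i + j)%N ->
  [|| (k <= i)%N, (k <= j)%N, (i == k - 1)%N && (q <= j)%N |
      (j == k - 1)%N && (q <= i)%N] ->
  absorbable (fun x => complex.Re (g x * (zc x ^+ i * conjc (zc x) ^+ j))).
Proof.
have sz := csmooth_at_zc (0 : 'rV[R]_2); have szb := csmooth_at_conj sz.
have main g' i' j' : csmooth_at 0 g' -> (k < i' + j')%N ->
    (k <= i')%N || ((i' == k - 1)%N && (q <= j')%N) ->
    absorbable (fun x => complex.Re (g' x * (zc x ^+ i' * conjc (zc x) ^+ j'))).
  move=> sg' ij; have sg0 : csmooth_at 0 (fun x => g' x * c0^-1).
    by apply: csmooth_atM => //; exact: csmooth_at_cst.
  case: (leqP k i') => [ki _|_ /= /andP[/eqP-> qj]].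
    exists (fun x => g' x * c0^-1 * (zc x ^+ (i' - k) * conjc (zc x) ^+ j')), (fun=> 0).
    split; last 2 first.
    - exact: csmooth_at_cst.
    - apply: near_all => x; congr complex.Re.
      rewrite mulr0 addr0 -{1}(subnKC ki) exprD.
      by field.
    - by do 2 apply: csmooth_atM => //; exact: csmooth_atX.
    - rewrite zc0 conjc0 !expr0n.
      by case: (j' =P 0)%N => [j0|_]; rewrite ?mulr0// (_ : (i' - k == 0)%N = false) ?mul0r ?mulr0//; lia.
  exists (fun=> 0), (fun x => g' x * c0^-1 * conjc (zc x) ^+ (j' - q)); split => //.
  - exact: csmooth_at_cst.
  - by apply: csmooth_atM => //; exact: csmooth_atX.
  - apply: near_all => x; congr complex.Re.
    by rewrite mulr0 add0r -{1}(subnKC qj) exprD; field.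
move=> sg ij /or4P[ki|kj|iq|jq]; try by apply: main => //; rewrite ?ki ?iq ?orbT.
  apply: (@eq_absorbable (fun x => complex.Re (conjc (g x) *
    (zc x ^+ j * conjc (zc x) ^+ i)))).
    apply: near_all => x; rewrite -[LHS]Re_conjc !conjcM !conjcX !conjcK.
    by rewrite [conjc _ ^+ _ * _]mulrC.
  by apply: main; [exact: csmooth_at_conj|rewrite addnC|rewrite kj].
apply: (@eq_absorbable (fun x => complex.Re (conjc (g x) *
    (zc x ^+ j * conjc (zc x) ^+ i)))).
  apply: near_all => x; rewrite -[LHS]Re_conjc !conjcM !conjcX !conjcK.
  by rewrite [conjc _ ^+ _ * _]mulrC.
by apply: main; [exact: csmooth_at_conj|rewrite addnC|rewrite jq orbT].
Qed.

End Absorbable.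

Section FormExpansion.
Context {R : realType}.
Implicit Types (f g : 'rV[R]_2 -> R[i]).

(** The [r]-th power of the maximal ideal, extended to complex-valued germs, in
    its generators adapted to [z] and [zbar]. *)
Definition form_germ r f : Prop := exists s : nat -> 'rV[R]_2 -> R[i],
  (forall i, csmooth_at 0 (s i)) /\
  \forall x \near (0 : 'rV[R]_2),
    f x = \sum_(i < r.+1) s i x * (zc x ^+ i * conjc (zc x) ^+ (r - i)).

Lemma form_germ0 f : csmooth_at 0 f -> form_germ 0 f.
Proof.
move=> sf; exists (fun=> f); split=> //; apply: near_all => x.
by rewrite big_ord1 !expr0 !mulr1.
Qed.

Lemma form_germ_step r f g a b : form_germ r f -> csmooth_at 0 a ->
  csmooth_at 0 b ->
  (\forall x \near (0 : 'rV[R]_2), g x = a x * zc x + b x * conjc (zc x)) ->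
  form_germ r.+1 (fun x => g x * f x).
Proof.
move=> [s [ss fE]] sa sb gE.
exists (fun i x => (if i is i'.+1 then a x * s i' x else 0) +
  (if (i <= r)%N then b x * s i x else 0)); split.
  move=> i; apply: csmooth_atD.
    by case: i => [|i]; [exact: csmooth_at_cst|exact: csmooth_atM].
  by case: (i <= r)%N; [exact: csmooth_atM|exact: csmooth_at_cst].
apply: near_imp2 fE gE => x -> ->.
under [RHS]eq_bigr do rewrite mulrDl.
rewrite big_split/= [X in _ = X + _]big_ord_recl mul0r add0r.
rewrite [X in _ = _ + X]big_ord_recr/= ltnn mul0r addr0 mulrDl !mulr_sumr; congr (_ + _).
  by apply: eq_bigr => i _; rewrite /= /bump /= add1n subSS exprS; ring.
apply: eq_bigr => i _; have ir : (i <= r)%N by rewrite -ltnS.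
by rewrite ir subSn// exprS; ring.
Qed.

Lemma form_germD r f g : form_germ r f -> form_germ r g ->
  form_germ r (fun x => f x + g x).
Proof.
move=> [s [ss fE]] [t [st gE]]; exists (fun i x => s i x + t i x); split.
  by move=> i; exact: csmooth_atD.
apply: near_imp2 fE gE => x -> ->; rewrite -big_split/=.
by apply: eq_bigr => i _; rewrite mulrDl.
Qed.

Lemma form_germMl r f g : csmooth_at 0 g -> form_germ r f ->
  form_germ r (fun x => g x * f x).
Proof.
move=> sg [s [ss fE]]; exists (fun i x => g x * s i x); split.
  by move=> i; exact: csmooth_atM.
apply: near_imp fE => x ->; rewrite mulr_sumr.
by apply: eq_bigr => i _; rewrite mulrA.
Qed.

Lemma eq_form_germ r f g : (\forall x \near (0 : 'rV[R]_2), f x = g x) ->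
  form_germ r f -> form_germ r g.
Proof.
move=> fg [s [ss fE]]; exists s; split=> //.
by apply: near_imp2 fg fE => x ->.
Qed.

(** By Hadamard's lemma each factor is a smooth combination of the two
    coordinates, hence of [z] and [zbar]. *)
Lemma form_germ_prod r (g : 'I_r -> 'rV[R]_2 -> R) :
  (forall j, maximal_ideal (g j)) ->
  form_germ r (fun x => real_complex R (\prod_(j < r) g j x)).
Proof.
elim: r g => [|r IH] g gm.
  apply: form_germ0; under eq_fun do rewrite big_ord0.
  exact: csmooth_at_cst.
have [/smooth_germ_smooth_at sg g0] := gm ord0.
have [G sG gE] := hadamard sg g0.
pose a x : R[i] := Complex (G 0 x / 2) (- (G 1 x / 2)).
pose b x : R[i] := Complex (G 0 x / 2) (G 1 x / 2).
have sG2 j : smooth_at 0 (fun x => G j x / 2).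
  by apply: smooth_atM => //; exact: smooth_at_cst.
have sa : csmooth_at 0 a by split; [exact: sG2|exact: smooth_atN].
have sb : csmooth_at 0 b by split; exact: sG2.
have gab : \forall x \near (0 : 'rV[R]_2),
    real_complex R (g ord0 x) = a x * zc x + b x * conjc (zc x).
  apply: near_imp gE => x ->; rewrite big_ord_recl big_ord1.
  have -> : lift ord0 ord0 = 1 :> 'I_2 by exact: val_inj.
  have -> : ord0 = 0 :> 'I_2 by exact: val_inj.
  by apply: complex_eqP; rewrite ?ReD ?ImD ?ReM ?ImM /zc /a /b /=; field.
have := form_germ_step (IH (fun j => g (lift ord0 j)) (fun j => gm _)) sa sb gab.
apply: eq_form_germ; apply: near_all => x.
by rewrite big_ord_recl rmorphM.
Qed.

Lemma maximal_ideal_pow_form r (f : 'rV[R]_2 -> R) : maximal_ideal_pow r f ->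
  form_germ r (fun x => real_complex R (f x)).
Proof.
move=> [N [c [g [sc gm fE]]]].
apply: (@eq_form_germ _ (fun x => \sum_(i < N)
    real_complex R (c i x) * real_complex R (\prod_(j < r) g i j x))).
  apply: near_imp fE => x ->; rewrite rmorph_sum.
  by apply: eq_bigr => i _; rewrite rmorphM.
elim: N c g sc gm {fE} => [|N IH] c g sc gm.
  exists (fun _ _ => 0); split; first by move=> i; exact: csmooth_at_cst.
  by apply: near_all => x; rewrite big_ord0 big1// => i _; rewrite mul0r.
under eq_fun do rewrite big_ord_recl.
apply: form_germD; last by apply: (IH (fun i => c (lift ord0 i)) (fun i => g (lift ord0 i))).
apply: form_germMl; last exact: form_germ_prod.
by split; [exact: (smooth_germ_smooth_at (sc ord0))|exact: smooth_at_cst].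
Qed.

End FormExpansion.

(** * The theorem *)

Section PolynomialPerturbations.
Context {R : realType}.

Lemma mdeg2 (m : multinom 2) : mdeg m = (m 0%R + m 1%R)%N.
Proof.
by rewrite mdegE big_ord_recl big_ord1; congr (m _ + m _)%N; exact: val_inj.
Qed.

(** Setting the first coordinate to 1 loses nothing on a homogeneous polynomial;
    what remains is a polynomial in one variable that vanishes everywhere. *)
Lemma homogeneous_poly_fun_eq0 d (p : mpoly 2 R) : homogeneous_poly d p ->
  (forall x, poly_fun p x = 0) -> p = 0.
Proof.
move=> /dhomogP pd p0; apply/eqP; apply: contraT => pN0.
have [m mp] : exists m, m \in msupp p.
  case E : (msupp p) pN0 => [|m l]; first by rewrite -msupp_eq0 E.
  by exists m; rewrite mem_head.
pose P : {poly R} := \sum_(m <- msupp p) mcoeff m p *: 'X^(m 1).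
have P0 t : P.[t] = 0.
  rewrite -(p0 (\row_j (if j == 0 then 1 else t))) /poly_fun mevalE horner_sum.
  apply: eq_bigr => m' _; rewrite hornerZ hornerXn big_ord_recl big_ord1 !mxE/=.
  by rewrite expr1n mul1r; congr (_ * _ ^+ m' _); exact: val_inj.
have PE : P = 0.
  apply: (@roots_geq_poly_eq0 _ _ [seq i%:R | i <- iota 0 (size P)]).
  - by apply/allP => _ /mapP[i _ ->]; apply/rootP; exact: P0.
  - by rewrite map_inj_uniq ?iota_uniq//; apply: mulrIn; rewrite oner_eq0.
  - by rewrite size_map size_iota.
have : P`_(m 1) = mcoeff m p.
  rewrite /P coef_sum (bigD1_seq m) ?msupp_uniq//= coefZ coefXn eqxx mulr1.
  rewrite big_seq_cond big1 ?addr0// => m' /andP[m'p m'm].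
  rewrite coefZ coefXn; case: eqP => [e|_]; rewrite ?mulr0//.
  case/eqP: m'm; apply/mnmP; elim/ord2E; last by rewrite e.
  have : mdeg m' = mdeg m := etrans (pd m' m'p) (esym (pd m mp)).
  by rewrite !mdeg2 e => /addIn.
rewrite PE coef0 => /esym/eqP; rewrite mcoeff_eq0 => /negP[].
exact: mp.
Qed.

Lemma poly_funE (p : mpoly 2 R) x : poly_fun p x =
  \sum_(m <- msupp (to_zzbar p)) complex.Re (mcoeff m (to_zzbar p) *
    (zc x ^+ m 0 * conjc (zc x) ^+ m 1)).
Proof.
rewrite -Re_sum; have := congr1 (@complex.Re R) (meval_to_zzbar p x).
rewrite /= => <-; rewrite mevalE; congr complex.Re; apply: eq_bigr => m _.
rewrite big_ord_recl big_ord1.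
have -> : zzbar x ord0 = zc x by [].
have -> : zzbar x (lift ord0 ord0) = conjc (zc x) by [].
by congr (_ * (_ ^+ m _ * _ ^+ m _)); exact: val_inj.
Qed.

Lemma msupp_to_zzbar d (p : mpoly 2 R) s m : homogeneous_poly d p ->
  iter s (@laplacian R) p = 0 -> m \in msupp (to_zzbar p) ->
  (m 0%R + m 1%R = d)%N /\ ((m 0%R < s)%N || (m 1%R < s)%N).
Proof.
move=> hp Lp mp; split.
  have /dhomogP/(_ m mp) := to_zzbar_homog hp.
  by rewrite -mdeg2.
rewrite !ltnNge -negb_and; apply: contraL mp => /andP[s0 s1].
by rewrite -mcoeff_eq0; apply/eqP; exact: laplacian_kernel Lp m s0 s1.
Qed.

(** A harmonic form only has the monomials [z ^+ k] and [zbar ^+ k]; the second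
    becomes the first by conjugation under the real part. *)
Lemma harmonic_poly_funE k (h : mpoly 2 R) : (0 < k)%N -> h != 0 ->
  homogeneous_poly k h -> harmonic_poly h ->
  exists2 c0 : R[i], c0 != 0 &
    forall x, poly_fun h x = complex.Re (c0 * zc x ^+ k).
Proof.
move=> k0 hN0 hk hh; pose q := to_zzbar h.
pose c0 : R[i] := \sum_(m <- msupp q)
  if m 1 == 0%N then mcoeff m q else conjc (mcoeff m q).
have hE x : poly_fun h x = complex.Re (c0 * zc x ^+ k).
  rewrite poly_funE /c0 mulr_suml Re_sum !big_seq; apply: eq_bigr => m mq.
  have [mk] := @msupp_to_zzbar k h 1 m hk hh mq; rewrite !ltnS !leqn0.
  case: (m 1 =P 0%N) => [m10 _|_]; last rewrite orbF => /eqP m00.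
    by rewrite m10 expr0 mulr1; move: mk; rewrite m10 addn0 => ->.
  rewrite -[LHS]Re_conjc !conjcM !conjcX conjcK m00 expr0 mul1r.
  by move: mk; rewrite m00 add0n => ->.
exists c0 => //; apply: contra hN0 => /eqP c00; apply/eqP.
apply: homogeneous_poly_fun_eq0 hk _ => x.
by rewrite hE c00 mul0r.
Qed.

(** The arithmetical hypothesis says that a power of [zbar] below the order [s]
    of the kernel leaves a power of [z] that can be absorbed; the other half of
    the monomials follows by conjugation. *)
Lemma absorbable_poly_fun k q (c0 : R[i]) d s (p : mpoly 2 R) : c0 != 0 ->
  (k < d)%N ->
  homogeneous_poly d p -> iter s (@laplacian R) p = 0 ->
  (forall a b, (a + b = d)%N -> (b < s)%N ->
     (k <= a)%N \/ a = (k - 1)%N /\ (q <= b)%N) ->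
  absorbable k q c0 (poly_fun p).
Proof.
move=> c0N0 kd hp Lp H.
rewrite (_ : poly_fun p = fun x => \sum_(m <- msupp (to_zzbar p))
  complex.Re (mcoeff m (to_zzbar p) * (zc x ^+ m 0 * conjc (zc x) ^+ m 1))); last first.
  by apply/funext => x; exact: poly_funE.
apply: absorbable_sum => m mp.
have [md ms] := msupp_to_zzbar hp Lp mp.
apply: (@absorbable_monomial _ k q c0 c0N0 (fun=> mcoeff m (to_zzbar p))).
- exact: csmooth_at_cst.
- by rewrite md.
- case/orP: ms => ms.
    have md' : (m 1%R + m 0%R = d)%N by rewrite addnC.
    by have [->|[-> ->]] := H _ _ md' ms; rewrite ?eqxx !orbT.
  by have [->|[-> ->]] := H _ _ md ms; rewrite ?eqxx ?orbT.
Qed.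

End PolynomialPerturbations.

Theorem theorem1 (R : realType) (k : nat) (h : mpoly 2 R)
    (rho : nat -> mpoly 2 R) (Rem : 'rV[R]_2 -> R) :
  (5 <= k)%N ->
  h != 0 ->
  homogeneous_poly k h ->
  harmonic_poly h ->
  (forall s : nat, (1 <= s <= k - 4)%N ->
     ker_laplacian (k + s) (sigma k s) (rho s)) ->
  maximal_ideal_pow (2 * k - 3) Rem ->
  right_equivalent
    (poly_fun h)
    (fun x => poly_fun h x
              + \sum_(1 <= s < (k - 4).+1) poly_fun (rho s) x
              + Rem x).
Proof.
move=> k5 hN0 hk hh rhoK RemM.
have k0 : (0 < k)%N by apply: leq_trans k5.
have [c0 c0N0 hE] := harmonic_poly_funE k0 hN0 hk hh.
(* the least [q] with [k - 1 <= 2 * q] *)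
pose q := k./2.
have kE := odd_double_half k; rewrite -/q -muln2 in kE.
have odd1 : (odd k <= 1)%N by case: (odd k).
have rho_abs : absorbable k q c0 (fun x => \sum_(1 <= s < (k - 4).+1) poly_fun (rho s) x).
  apply: absorbable_sum => s; rewrite mem_index_iota ltnS => sk.
  have [rh rL] := rhoK s sk; move: sk => /andP[s1 sk].
  apply: (absorbable_poly_fun c0N0 _ rh rL); first by lia.
  (* With [b <= s] the exponent [a] is at least [k]. Beyond the threshold also
     [b = s + 1] occurs; then [a = k - 1], and [q <= b] because
     [k - 3 <= 2 * s]. *)
  move=> a b ab; rewrite /sigma; case: ifP => ks bs; lia.
have Rem_abs : absorbable k q c0 Rem.
  have [s [ss RE]] := maximal_ideal_pow_form RemM.
  apply: (@eq_absorbable _ k q c0 (fun x => \sum_(i <- index_enum 'I_(2 * k - 3).+1)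
     complex.Re (s i x * (zc x ^+ i * conjc (zc x) ^+ (2 * k - 3 - i))))).
    by apply: near_imp RE => x Ex; rewrite -Re_sum -Ex.
  apply: absorbable_sum => i _; apply: absorbable_monomial => //.
  (* two exponents with sum [2 * k - 3] are not both below [k - 1]; if the
     larger one is [k - 1], the other is [k - 2], which is at least [q] *)
    by have := ltn_ord i; lia.
  by have := ltn_ord i; lia.
have [W [c [sW W0 sc E]]] := absorbableD rho_abs Rem_abs.
have k2 : (1 < k)%N by lia.
have q2 : (1 < q)%N by lia.
have kq : (k - 1 <= q * 2)%N by lia.
have qk : (q + 2 < k)%N by lia.
have [phi dphi phiE] := absorb_perturbation c0N0 k2 q2 kq qk sW sc W0.
exists phi; first exact: dphi.
apply: near_imp2 E phiE => x Ex; rewrite hE => ->.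
rewrite -addrA Ex hE -ReD; congr complex.Re; ring.
Qed.
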